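(* Let $\alpha\in(0,1)$, let $A$ be a polynomial with complex coefficients of degree $m\ge 0$, and let $u_0\in\mathbb C$. Then the solution $u$ of the Cauchy problem $$\left(\mathbb D^{(\alpha)}u\right)(t)=A(t^\alpha)\,u(t),\quad t>0,\qquad u(0)=u_0,$$ has the form $u(t)=v(t^\alpha)$, $t\ge 0$, where $v$ is an entire function whose order does not exceed $(1+m)/\alpha$.
   Context: For $\alpha\in(0,1)$, the Riemann-Liouville fractional integral of order $1-\alpha$ is $$\left(I_{0+}^{1-\alpha}\varphi\right)(t)=\frac1{\Gamma(1-\alpha)}\int_0^t(t-\tau)^{-\alpha}\varphi(\tau)\,d\tau ,$$ and the Riemann-Liouville fractional derivative of order $\alpha$ is $\left(D_{0+}^\alpha\varphi\right)(t)=\frac{d}{dt}\left(I_{0+}^{1-\alpha}\varphi\right)(t)$, provided $I_{0+}^{1-\alpha}\varphi$ is absolutely continuous on each $[0,T]$. For a continuous function $\varphi$ on $[0,\infty)$ possessing a Riemann-Liouville derivative of order $\alpha$, the Caputo-Dzhrbashyan (regularized) fractional derivative is $$\left(\mathbb D^{(\alpha)}\varphi\right)(t)=\left(D_{0+}^\alpha\varphi\right)(t)-\frac{1}{t^\alpha\,\Gamma(1-\alpha)}\varphi(0).$$ A solution is a continuous (complex-valued) function on $[0,\infty)$ possessing this derivative and satisfying the equation for $t>0$; the solution of the Cauchy problem is unique. The order of an entire function is the usual one: $\limsup_{R\to\infty}\frac{\log\log\max_{|z|=R}|v(z)|}{\log R}$ (for $v$ bounded the order is taken to be $0$). *)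

(* Defs.v *)
(* MathComp-Analysis: R is an arbitrary realType, and R[i] (mathcomp-real-closed)
   is the field of complex numbers over it. *)
From HB Require Import structures.
From mathcomp Require Import all_boot all_order all_algebra.
From mathcomp Require Import complex.
From mathcomp Require Import all_classical all_reals all_analysis.

Set Implicit Arguments.
Unset Strict Implicit.
Unset Printing Implicit Defensive.

Import Order.TTheory GRing.Theory Num.Theory.
Import numFieldNormedType.Exports.

Local Open Scope classical_set_scope.
Local Open Scope ring_scope.
Local Open Scope complex_scope.

(* R[i] seen as a numFieldType, from which its norm topology is inferred. *)
Definition Cplx (R : realType) : numFieldType := R[i].

(* The modulus with values in R; the norm `|z| of R[i] has values in R[i]. *)
Definition cmod (R : realType) (z : R[i]) : R := Normc.normc z.

(* The library integrates and differentiates real-valued functions only, so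
   complex-valued functions of a real variable are treated componentwise. *)
Definition Cintegral (R : realType) (D : set R) (f : R -> R[i]) : R[i] :=
  (\int[lebesgue_measure]_(x in D) complex.Re (f x)) +i*
  (\int[lebesgue_measure]_(x in D) complex.Im (f x)).

Definition Cderivable (R : realType) (f : R -> R[i]) (t : R) : Prop :=
  derivable (fun x => complex.Re (f x)) t 1 /\
  derivable (fun x => complex.Im (f x)) t 1.

Definition Cderive (R : realType) (f : R -> R[i]) (t : R) : R[i] :=
  derive1 (fun x => complex.Re (f x)) t +i* derive1 (fun x => complex.Im (f x)) t.

Definition abs_continuous (R : realType) (a b : R) (f : R -> R[i]) : Prop :=
  forall e : R, 0 < e -> exists2 d : R, 0 < d &
    forall (n : nat) (x y : 'I_n -> R),
      (forall i, a <= x i /\ x i <= y i /\ y i <= b) ->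
      trivIset setT (fun i => [set` `]x i, y i[]) ->
      \sum_(i < n) (y i - x i) < d ->
      \sum_(i < n) cmod (f (y i) - f (x i)) < e.

Definition Gamma (R : realType) (x : R) : R :=
  \int[lebesgue_measure]_(t in `]0, +oo[) (t `^ (x - 1) * expR (- t)).

(* The Riemann-Liouville integral of order 1 - alpha (not alpha).  At s = t the
   integrand takes the junk value 0, since 0 `^ (- alpha) = 0. *)
Definition RLint (R : realType) (alpha : R) (phi : R -> R[i]) (t : R) : R[i] :=
  ((Gamma (1 - alpha))^-1)%:C *
  Cintegral `[0, t] (fun s => ((t - s) `^ (- alpha))%:C * phi s).

Definition has_RLderive (R : realType) (alpha : R) (phi : R -> R[i]) : Prop :=
  forall T : R, 0 < T -> abs_continuous 0 T (RLint alpha phi).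

Definition RLderive (R : realType) (alpha : R) (phi : R -> R[i]) (t : R) : R[i] :=
  Cderive (RLint alpha phi) t.

Definition Caputo (R : realType) (alpha : R) (phi : R -> R[i]) (t : R) : R[i] :=
  RLderive alpha phi t - ((t `^ alpha * Gamma (1 - alpha))^-1)%:C * phi 0.

(* Functions on [0, +oo[ are represented by total functions on R whose values
   on the negative axis are irrelevant.  Absolute continuity only yields a
   derivative almost everywhere, while the equation is required at every t > 0:
   hence the explicit differentiability requirement. *)
Definition Cauchy_solution (R : realType) (alpha : R) (A : {poly R[i]})
    (u0 : R[i]) (u : R -> R[i]) : Prop :=
  [/\ {within `[0, +oo[, continuous (u : R -> Cplx R)},
      has_RLderive alpha u,
      forall t : R, 0 < t ->
        Cderivable (RLint alpha u) t /\
        Caputo alpha u t = A.[(t `^ alpha)%:C] * u t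
    & u 0 = u0].

Definition entire (R : realType) (v : R[i] -> R[i]) : Prop :=
  forall z : R[i], derivable (v : (Cplx R)^o -> (Cplx R)^o) z 1.

Definition max_modulus (R : realType) (v : R[i] -> R[i]) (r : R) : R :=
  sup [set cmod (v z) | z in [set z : R[i] | cmod z = r]].

Definition entire_order (R : realType) (v : R[i] -> R[i]) : \bar R :=
  if `[< exists M : R, forall z : R[i], cmod (v z) <= M >] then 0%E
  else limf_esup (fun r : R => (ln (ln (max_modulus v r)) / ln r)%:E)
                 (pinfty_nbhs R).

(* Main.v *)
Require Import Defs.
From HB Require Import structures.
From mathcomp Require Import all_boot all_order all_algebra.
From mathcomp Require Import complex.
From mathcomp Require Import all_classical all_reals all_analysis.
From mathcomp Require Import measurable_realfun.
From mathcomp Require Import ring lra.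

Import Order.TTheory GRing.Theory Num.Theory.
Import numFieldNormedType.Exports.

(** Why the theorem holds.  The Riemann-Liouville integral of order
    1 - alpha maps t^(alpha n) to a constant times t^(alpha n + 1 - alpha), as
    the substitution s = t x shows, so the Caputo derivative maps
    t^(alpha n) to lambda_n t^(alpha (n - 1)) for n >= 1 and kills constants.
    Here lambda_n is [RL_symbol]: a Beta integral, never needed in closed
    form.  A series u(t) = sum_n c_n t^(alpha n) therefore solves the Cauchy
    problem when c_0 = u0 and
      lambda_(n+1) c_(n+1) = sum_(j <= m) a_j c_(n-j)      (A = sum_j a_j x^j).

    Growth.  Restricting the Beta integral to a window of width 1/(n+1) next to
    the singular endpoint gives lambda_n >= kappa n^alpha ([RL_symbol_ge]).  One
    step of the recursion gains a factor n^(-alpha) but reaches back at most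
    m + 1 indices, so every index gains n^(-sigma) with
    sigma = alpha / (m + 1): |c_n| <= |u0| L^n / (n!)^sigma ([coef_growth]).
    Since y^n / (n!)^sigma <= 2^(-n) exp (sigma (2 y)^(1/sigma))
    ([exprn_div_fact_powR_le]), the series v(z) = sum_n c_n z^n converges
    everywhere, with tails that are geometric in N uniformly on bounded sets,
    and |v(z)| <= C exp (K |z|^(1/sigma)), which is the claim on the order
    ([series_sum_entire], [entire_order_le]).

    Existence.  Uniform convergence allows integrating the series term by term
    against both integrable weights (t - s)^(-alpha) and s^(-alpha); the two
    results agree monomial by monomial, so the Riemann-Liouville integral of u
    is the indefinite integral of an integrable density, continuous for t > 0
    ([RL_series], [RLint_series]).  Absolute continuity and the equation are
    then read off this density ([series_solution]).

    Uniqueness.  For the difference h of two solutions, the fundamental theorem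
    of calculus turns the equation into Abel's integral equation
    J^(1-alpha) h = Gamma(1-alpha) J^1 (a h), where a(t) = A(t^alpha) and
    J^b g (x) is the unnormalized convolution [RL_conv b g x], the integral
    over 0 < s < x of (x - s)^(b-1) g(s).
    By Tonelli's theorem J^alpha J^(1-alpha) = B(alpha, 1-alpha) J^1
    ([RL_conv_comp]), so the integral of h is a multiple of J^alpha J^1 (a h).
    If h vanishes before t0 and is at most M up to t1, the increments of the
    latter are at most a constant times M (t1 - t0)^alpha times the increment
    of the argument; hence |h| itself is at most a constant times
    M (t1 - t0)^alpha on [t0, t1[ ([Abel_local_bound]).  On a short interval
    this improves the bound M by a factor 2, so that h vanishes there, and one
    proceeds interval by interval ([Volterra_zero]). *)

Set Implicit Arguments.
Unset Strict Implicit.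
Unset Printing Implicit Defensive.

Local Open Scope classical_set_scope.
Local Open Scope ring_scope.
Local Open Scope complex_scope.

(** * Affine change of variables for the Lebesgue measure *)

Section Affine.
Variable R : realType.
Notation mu := (@lebesgue_measure R).

Definition affine (c d : R) : measurableTypeR R -> measurableTypeR R :=
  fun x => c * x + d.

Lemma measurable_affine c d : measurable_fun setT (affine c d).
Proof.
by apply: measurable_funD => //; apply: measurable_funM.
Qed.

(** The image measure under an affine map; the instance is spelled out since the
    measurability of the map cannot be inferred from the expression. *)
Let affine_image c d : {measure set (measurableTypeR R) -> \bar R} :=
  measure_function_pushforward__canonical__measure_function_Measure
    mu (measurable_affine c d).

(** Both sides are measures, and they agree on half-open intervals; the case
    c < 0 turns such an interval around. *)
Lemma lebesgue_measure_affine (c d : R) (A : set (measurableTypeR R)) :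
  c != 0 -> measurable A ->
  (mu A = `|c|%:E * pushforward mu (affine c d) A)%E.
Proof.
move=> c0 mA.
rewrite -[RHS]/(mscale (NngNum (normr_ge0 c)) (affine_image c d) A).
apply: lebesgue_measure_unique => // _ [[a b]] _ <-.
rewrite -[RHS]/(`|c|%:E * mu (affine c d @^-1` `]a, b]))%E.
have [cp|cn] : 0 < c \/ c < 0 by case: (ltgtP 0 c) c0; auto.
- have -> : affine c d @^-1` `]a, b] = `](a - d) / c, (b - d) / c]%classic.
    apply/seteqP; split => x /=; rewrite !in_itv /= /affine;
      by rewrite ltr_pdivrMr // ler_pdivlMr // mulrC ltrBlDr lerBrDr.
  rewrite !lebesgue_measure_itv /= !lte_fin ltr_pM2r ?invr_gt0 // ltrD2r.
  case: ltP => _; last by rewrite mule0.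
  by rewrite -!EFinD -EFinM gtr0_norm //; congr (_%:E); field; rewrite gt_eqF.
- have -> : affine c d @^-1` `]a, b] = `[(b - d) / c, (a - d) / c[%classic.
    apply/seteqP; split => x /=; rewrite !in_itv /= /affine andbC;
      by rewrite ltr_ndivlMr // ler_ndivrMr // mulrC ltrBlDr lerBrDr.
  rewrite !lebesgue_measure_itv /= !lte_fin ltr_nM2r ?invr_lt0 // ltrD2r.
  case: ltP => _; last by rewrite mule0.
  by rewrite -!EFinD -EFinM ltr0_norm //; congr (_%:E); field; rewrite lt_eqF.
Qed.

Lemma ge0_integral_affine (c d : R) (D : set R) (f : R -> \bar R) :
  c != 0 -> measurable D -> measurable_fun D f ->
  (forall x, D x -> (0 <= f x)%E) ->
  (\int[mu]_(x in D) f x =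
   `|c|%:E * \int[mu]_(x in [set x | D (c * x + d)%R]) f (c * x + d)%R)%E.
Proof.
move=> c0 mD mf f0.
rewrite -(@ge0_integral_pushforward _ _ _ _ R _ (measurable_affine c d) mu D f) //;
  last by move=> x; rewrite inE; exact: f0.
rewrite -(ge0_integral_mscale (affine_image c d) _ (NngNum (normr_ge0 c))) //=.
by apply: eq_measure_integral => A mA _; apply: lebesgue_measure_affine.
Qed.

End Affine.

(** * Integrals of powers *)

Section PowerIntegrals.
Variable R : realType.
Notation mu := (@lebesgue_measure R).

Lemma continuous_powR (b x : R) : 0 < x -> {for x, continuous (fun s : R => s `^ b)}.
Proof.
move=> x0; apply: differentiable_continuous; apply/derivable1_diffP.
by apply: derivable_powR; rewrite in_itv /= x0.
Qed.

Lemma integral_powR_pos (b e t : R) : 0 < b -> 0 < e -> e < t ->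
  (\int[mu]_(s in `[e, t]) (s `^ (b - 1))%:E = (t `^ b / b - e `^ b / b)%:E)%E.
Proof.
move=> b0 e0 et.
rewrite (@continuous_FTC2 R (fun s => s `^ (b - 1)) (fun s => s `^ b / b)) //.
- apply: continuous_in_subspaceT => x; rewrite inE /= in_itv /= => /andP[ex _].
  exact: continuous_powR (lt_le_trans e0 ex).
- have cc x : 0 < x -> {for x, continuous (fun s : R => s `^ b / b)}.
    by move=> x0; apply: cvgM; [exact: continuous_powR|exact: cvg_cst].
  split.
  + move=> x; rewrite in_itv /= => /andP[ex _].
    apply: derivableM => //; apply: derivable_powR.
    by rewrite in_itv /= (lt_trans e0 ex).
  + by apply: cvg_at_right_filter; apply: cc.
  + by apply: cvg_at_left_filter; apply: cc; exact: lt_trans et.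
- move=> x; rewrite in_itv /= => /andP[ex _].
  have x0 : 0 < x := lt_trans e0 ex.
  rewrite derive1E deriveM //; last by apply: derivable_powR; rewrite in_itv /= x0.
  rewrite derive_cst scaler0 add0r.
  have [_ ->] := is_derive1_powR b x0.
  by rewrite /GRing.scale /=; field; rewrite gt_eqF.
Qed.

(** The integrand is unbounded at 0 when b < 1, so the fundamental theorem of
    calculus is applied on [t / (n + 2), t] and n tends to infinity. *)
Lemma integral_powR (b t : R) : 0 < b -> 0 <= t ->
  (\int[mu]_(s in `[0%R, t]) (s `^ (b - 1))%:E = (t `^ b / b)%:E)%E.
Proof.
move=> b0; rewrite le_eqVlt => /predU1P[<-|t0].
  by rewrite set_itv1 integral_set1 powR0 ?gt_eqF // mul0r.
have mp : measurable_fun setT (fun s : R => (s `^ (b - 1))%:E).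
  by apply/measurable_EFinP; exact: measurable_powR.
rewrite -integral_itv_obnd_cbnd; last exact: measurable_funS mp.
pose F n : set R := `[t / n.+2%:R, t]%classic.
have Fe n : 0 < t / n.+2%:R < t.
  by rewrite divr_gt0 //= ltr_pdivrMr // ltr_pMr // ltr1n.
have -> : `]0, t]%classic = \bigcup_n F n.
  apply/seteqP; split => x /=; rewrite in_itv /=.
    move=> /andP[x0 xt]; exists (Num.truncn (t / x)) => //=.
    rewrite /F /= in_itv /= xt andbT ler_pdivrMr // mulrC -ler_pdivrMr //.
    by rewrite ltW // (lt_le_trans (truncnS_gt _)) // ler_nat.
  move=> [n _]; rewrite /F /= in_itv /= => /andP[xn ->].
  by rewrite andbT (lt_le_trans _ xn) //; case/andP: (Fe n).
have cv : (\int[mu]_(s in F n) (s `^ (b - 1))%:E @[n --> \oo] -->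
    \int[mu]_(s in \bigcup_n F n) (s `^ (b - 1))%:E)%E.
  apply: ge0_nondecreasing_set_cvg_integral.
  - apply/nondecreasing_seqP => n; rewrite subsetEset => x /=.
    rewrite /F /= !in_itv /= => /andP[xn ->]; rewrite andbT (le_trans _ xn) //.
    by rewrite ler_pM2l // lef_pV2 ?posrE ?ltr0n // ler_nat.
  - by move=> n; exact: measurable_itv.
  - by move=> n; apply: measurable_funS mp.
  - by move=> n x _; rewrite lee_fin powR_ge0.
apply: (cvg_unique _ cv) => //.
rewrite (_ : (fun n => _) = EFin \o (fun n => t `^ b / b - (t / n.+2%:R) `^ b / b)).
    apply: cvg_EFin; first exact: nearW.
    rewrite [X in _ --> X](_ : _ = t `^ b / b - 0 / b); last by rewrite mul0r subr0.
    apply: cvgB; first exact: cvg_cst.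
    apply: cvgM; last exact: cvg_cst.
    apply: (@cvg_comp _ _ _ (fun n => t / n.+2%:R) (fun s => s `^ b) _ 0^'+);
      last exact: powR_cvg0.
    move=> A [d /= d0 dA]; near=> n; apply: dA => /=.
      rewrite sub0r normrN gtr0_norm; last by case/andP: (Fe n).
      rewrite ltr_pdivrMr // mulrC -ltr_pdivrMr //.
      apply: lt_le_trans (truncnS_gt _) _; rewrite ler_nat ltnS leqW //.
      by near: n; exact: nbhs_infty_ge.
    by case/andP: (Fe n).
  apply/funext => n /=; have /andP[? ?] := Fe n.
  by rewrite -integral_powR_pos.
Unshelve. all: by end_near. Qed.

End PowerIntegrals.

(** * Beta integrals *)

Section RealIntegrable.
Context d (T : measurableType d) (R : realType) (mu : {measure set T -> \bar R}).
Variables (D : set T) (mD : measurable D).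

Lemma integrableD_EFin (f g : T -> R) : mu.-integrable D (EFin \o f) ->
  mu.-integrable D (EFin \o g) -> mu.-integrable D (EFin \o (fun x => f x + g x)).
Proof. exact: integrableD. Qed.

Lemma integrableZl_EFin (k : R) (f : T -> R) : mu.-integrable D (EFin \o f) ->
  mu.-integrable D (EFin \o (fun x => k * f x)).
Proof. exact: (integrableZl mD). Qed.

End RealIntegrable.

Section BetaIntegrals.
Variable R : realType.
Notation mu := (@lebesgue_measure R).
Implicit Types a b p q t : R.

Lemma measurable_powR_comp d (T : measurableType d) (D : set T) (f : T -> R) (e : R) :
  measurable_fun D f -> measurable_fun D (fun x => f x `^ e).
Proof. by move=> mf; exact: measurableT_comp (measurable_powR e) mf. Qed.

Lemma integral_powR_sub b p t : 0 < b -> p <= t ->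
  (\int[mu]_(s in `[p, t]) ((t - s) `^ (b - 1))%:E = ((t - p) `^ b / b)%:E)%E.
Proof.
move=> b0 pt.
rewrite -[RHS]integral_powR; [|exact: b0|by rewrite subr_ge0].
rewrite (@ge0_integral_affine R (-1) t `[0%R, (t - p)%R]%classic) //; first last.
- by move=> x _; rewrite lee_fin powR_ge0.
- by apply: measurable_funTS; apply/measurable_EFinP; exact: measurable_powR.
rewrite normrN1 mul1e; apply: congr2.
  apply/seteqP; split => x /=; rewrite !in_itv /= => /andP[? ?]; apply/andP; lra.
by apply/funext => x; rewrite mulN1r addrC.
Qed.

Definition beta_kernel a b (s : R) := (1 - s) `^ (a - 1) * s `^ (b - 1).

Definition Beta a b : R := \int[mu]_(s in `[0, 1]) beta_kernel a b s.

Lemma measurable_beta_kernel a b : measurable_fun setT (beta_kernel a b).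
Proof.
apply: measurable_funM; last exact: measurable_powR.
by apply: measurable_powR_comp; exact: measurable_funB.
Qed.

Lemma beta_kernel_ge0 a b s : 0 <= beta_kernel a b s.
Proof. by rewrite mulr_ge0 ?powR_ge0. Qed.

Let powR_half_le a s : 0 < a -> 2^-1 <= s <= 1 -> s `^ (a - 1) <= 2.
Proof.
move=> a0 /andP[s2 s1].
have s0 : 0 < s by apply: lt_le_trans s2.
have : s `^ (a - 1) <= s `^ (-1) by apply: ger_powR; [rewrite s0|lra].
move/le_trans; apply; rewrite powR_inv1 ?(ltW s0) //.
by rewrite invf_ple ?posrE.
Qed.

(** At most one of the two factors is large: on each half of [0, 1] the other
    one is at most 2.  This dominates the kernel by integrable powers. *)
Lemma beta_kernel_le a b s : 0 < a -> 0 < b -> 0 <= s <= 1 ->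
  beta_kernel a b s <= 2 * s `^ (b - 1) + 2 * (1 - s) `^ (a - 1).
Proof.
move=> a0 b0 /andP[s0 s1]; rewrite /beta_kernel.
have [s2|s2] := leP s 2^-1.
  rewrite -[leLHS]addr0 lerD ?mulr_ge0 ?powR_ge0 //.
  by rewrite ler_wpM2r ?powR_ge0 // powR_half_le //; lra.
rewrite -[leLHS]add0r lerD ?mulr_ge0 ?powR_ge0 //.
by rewrite mulrC ler_wpM2r ?powR_ge0 // powR_half_le // s1 andbT ltW.
Qed.

Lemma integrable_powR b t : 0 < b -> 0 <= t ->
  mu.-integrable `[0, t] (EFin \o (fun s : R => s `^ (b - 1))).
Proof.
move=> b0 t0; apply/integrableP; split.
  by apply: measurable_funTS; apply/measurable_EFinP; exact: measurable_powR.
under eq_integral do rewrite /= ger0_norm ?powR_ge0 //.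
by rewrite integral_powR // ltry.
Qed.

Lemma integrable_powR_sub b p t : 0 < b -> p <= t ->
  mu.-integrable `[p, t] (EFin \o (fun s : R => (t - s) `^ (b - 1))).
Proof.
move=> b0 t0; apply/integrableP; split.
  apply: measurable_funTS; apply/measurable_EFinP; apply: measurable_powR_comp.
  exact: measurable_funB.
under eq_integral do rewrite /= ger0_norm ?powR_ge0 //.
by rewrite integral_powR_sub // ltry.
Qed.

Lemma integrable_beta_kernel a b : 0 < a -> 0 < b ->
  mu.-integrable `[0, 1] (EFin \o beta_kernel a b).
Proof.
move=> a0 b0.
apply: (@le_integrable _ _ _ mu `[0%R, 1%R]%classic _ _ (EFin \o (fun s : R =>
    2 * s `^ (b - 1) + 2 * (1 - s) `^ (a - 1)))) => //.
- by apply: measurable_funTS; apply/measurable_EFinP; exact: measurable_beta_kernel.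
- move=> s /=; rewrite in_itv /= => s01; rewrite lee_fin ger0_norm ?beta_kernel_ge0 //.
  by rewrite ger0_norm ?addr_ge0 ?mulr_ge0 ?powR_ge0 // beta_kernel_le.
- by apply: integrableD_EFin => //; apply: integrableZl_EFin => //;
    [exact: integrable_powR|exact: integrable_powR_sub].
Qed.

Lemma EFin_Beta a b : 0 < a -> 0 < b ->
  (Beta a b)%:E = (\int[mu]_(s in `[0%R, 1%R]) (beta_kernel a b s)%:E)%E.
Proof.
move=> a0 b0; rewrite /Beta /Rintegral fineK //.
by apply: integrable_fin_num => //; exact: integrable_beta_kernel.
Qed.

Lemma integral_beta_scale a b p q : p < q ->
  (\int[mu]_(s in `[p, q]) ((q - s) `^ (a - 1) * (s - p) `^ (b - 1))%:E =
   ((q - p) `^ (a + b - 1))%:E *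
   \int[mu]_(s in `[0%R, 1%R]) (beta_kernel a b s)%:E)%E.
Proof.
move=> pq; have qp0 : 0 < q - p by rewrite subr_gt0.
rewrite (@ge0_integral_affine R (q - p) p `[p, q]%classic _ (lt0r_neq0 qp0));
  [|exact: measurable_itv| |by move=> x _; rewrite lee_fin mulr_ge0 ?powR_ge0];
  last first.
  apply: measurable_funTS; apply/measurable_EFinP; apply: measurable_funM;
  by apply: measurable_powR_comp; exact: measurable_funB.
rewrite (gtr0_norm qp0).
have -> : [set x | `[p, q]%classic ((q - p) * x + p)] = `[0, 1]%classic.
  apply/seteqP; split => x /=; rewrite !in_itv /= => /andP[? ?]; apply/andP; nra.
have mk : measurable_fun setT (EFin \o beta_kernel a b).
  by apply/measurable_EFinP; exact: measurable_beta_kernel.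
rewrite -ge0_integralZl_EFin; [|exact: measurable_itv
  |by move=> *; rewrite lee_fin mulr_ge0 ?powR_ge0| |exact: ltW]; last first.
  apply: measurable_funTS; apply/measurable_EFinP; apply: measurable_funM;
    apply: measurable_powR_comp; apply: measurable_funB => //;
    by apply: measurable_funD => //; apply: measurable_funM.
rewrite -ge0_integralZl_EFin; [|exact: measurable_itv
  |by move=> *; rewrite lee_fin beta_kernel_ge0|exact: measurable_funTS mk|exact: powR_ge0].
apply: eq_integral => x; rewrite inE /= in_itv /= => /andP[x0 x1].
rewrite -!EFinM; congr (_%:E).
have -> : q - ((q - p) * x + p) = (q - p) * (1 - x) by ring.
have -> : (q - p) * x + p - p = (q - p) * x by ring.
rewrite !powRM ?subr_ge0 ?(ltW pq) // /beta_kernel.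
have -> : a + b - 1 = 1 + ((a - 1) + (b - 1)) by ring.
have D (e f : R) : (q - p) `^ (e + f) = (q - p) `^ e * (q - p) `^ f.
  by apply: powRD; rewrite (gt_eqF qp0) implybT.
rewrite (D 1) (D (a - 1) (b - 1)) powRr1 ?(ltW qp0) //; ring.
Qed.

(** Keep only the part of the integral near the endpoint 1, where the second
    factor of the kernel can be bounded below. *)
Lemma Beta_ge a b p (k : R) : 0 < a -> 0 < b -> 0 <= p <= 1 -> 0 <= k ->
  (forall s, p <= s <= 1 -> k <= s `^ (b - 1)) ->
  k * ((1 - p) `^ a / a) <= Beta a b.
Proof.
move=> a0 b0 /andP[p0 p1] k0 kle.
have mk : measurable_fun setT (EFin \o beta_kernel a b).
  by apply/measurable_EFinP; exact: measurable_beta_kernel.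
have ms : measurable_fun setT (EFin \o (fun s : R => (1 - s) `^ (a - 1))).
  by apply/measurable_EFinP; apply: measurable_powR_comp; exact: measurable_funB.
rewrite -lee_fin EFin_Beta // EFinM -(integral_powR_sub a0 p1).
rewrite -ge0_integralZl_EFin; [|exact: measurable_itv
  |by move=> *; rewrite lee_fin powR_ge0|exact: measurable_funTS ms|exact: k0].
apply: (@le_trans _ _ (\int[mu]_(s in `[p, 1%R]) (beta_kernel a b s)%:E)%E).
  apply: ge0_le_integral.
  - exact: measurable_itv.
  - by move=> s _; rewrite -EFinM lee_fin mulr_ge0 ?powR_ge0.
  - by apply: measurable_funeM; exact: measurable_funTS ms.
  - exact: measurable_funTS mk.
  - move=> s /=; rewrite in_itv /= => s1; rewrite -EFinM lee_fin /beta_kernel.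
    by rewrite mulrC ler_wpM2l ?powR_ge0 ?kle.
apply: ge0_subset_integral; [exact: measurable_itv|exact: measurable_itv
  |exact: measurable_funTS mk|by move=> s _; rewrite lee_fin beta_kernel_ge0|].
by move=> s /=; rewrite !in_itv /= => /andP[ps ->]; rewrite (le_trans p0 ps).
Qed.

Lemma Beta_gt0 a b : 0 < a -> 0 < b -> 0 < Beta a b.
Proof.
move=> a0 b0; pose k : R := Num.min 1 (2^-1 `^ (b - 1)).
have k0 : 0 < k by rewrite lt_min ltr01 powR_gt0.
apply: (lt_le_trans _ (Beta_ge (p := 2^-1) (k := k) a0 b0 _ _ _)).
- by rewrite mulr_gt0 // divr_gt0 // powR_gt0 //; lra.
- by lra.
- exact: ltW.
- move=> s /andP[s2 s1]; have s0 : 0 < s by apply: lt_le_trans s2.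
  have [b1|b1] := leP b 1.
    rewrite ge_min; apply/orP; left; rewrite -[leLHS](powRr0 s).
    by apply: ger_powR; [rewrite s0|lra].
  rewrite ge_min; apply/orP; right.
  by apply: ge0_ler_powR; rewrite ?nnegrE; lra.
Qed.

End BetaIntegrals.

(** * Positivity of the Gamma integral *)

Section GammaPositive.
Variable R : realType.
Notation mu := (@lebesgue_measure R).

(** A divergent integral would get the value 0, so finiteness is part of the
    claim: the integrand is at most t^(x - 1) on ]0, 1] and exp (- t) on
    ]1, +oo[.  The part over ]0, 1] is positive. *)
Lemma Gamma_gt0 (x : R) : 0 < x <= 1 -> 0 < Gamma x.
Proof.
move=> /andP[x0 x1].
pose f (t : R) := t `^ (x - 1) * expR (- t).
have f0 t : 0 <= f t by rewrite mulr_ge0 ?powR_ge0 ?expR_ge0.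
have mexp : measurable_fun setT (fun t : R => expR (- t)).
  by apply: measurableT_comp => //; exact: measurable_expR.
have mf : measurable_fun setT (EFin \o f).
  by apply/measurable_EFinP; apply: measurable_funM => //; exact: measurable_powR.
have mp : measurable_fun setT (EFin \o (fun t : R => t `^ (x - 1))).
  by apply/measurable_EFinP; exact: measurable_powR.
have I01 : (\int[mu]_(t in `]0%R, 1%R]) (t `^ (x - 1))%:E = (x^-1)%:E)%E.
  rewrite integral_itv_obnd_cbnd; last exact: measurable_funTS mp.
  by rewrite integral_powR // powR1 div1r.
rewrite /Gamma /Rintegral -/f; apply: fine_gt0; apply/andP; split.
  apply: (@lt_le_trans _ _ (\int[mu]_(t in `]0%R, 1%R]) (f t)%:E)%E); last first.
    apply: ge0_subset_integral; [exact: measurable_itv|exact: measurable_itv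
      |exact: measurable_funTS mf|by move=> t _; rewrite lee_fin; exact: f0|].
    by move=> t /=; rewrite !in_itv /= => /andP[->].
  apply: (@lt_le_trans _ _ ((expR (- 1))%:E *
      \int[mu]_(t in `]0%R, 1%R]) (t `^ (x - 1))%:E)%E).
    by rewrite I01 -EFinM lte_fin mulr_gt0 ?expR_gt0 ?invr_gt0.
  rewrite -ge0_integralZl_EFin; [|exact: measurable_itv
    |by move=> *; rewrite lee_fin powR_ge0|exact: measurable_funTS mp|exact: expR_ge0].
  apply: ge0_le_integral.
  - exact: measurable_itv.
  - by move=> s _; rewrite -EFinM lee_fin mulr_ge0 ?powR_ge0 ?expR_ge0.
  - by apply: measurable_funeM; exact: measurable_funTS mp.
  - exact: measurable_funTS mf.
  - move=> s /=; rewrite in_itv /= => /andP[_ s1]; rewrite -EFinM lee_fin /f mulrC.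
    by rewrite ler_wpM2l ?powR_ge0 // ler_expR lerN2.
have -> : `]0, +oo[%classic = `]0%R, 1%R] `|` `]1%R, +oo[ :> set R.
  apply/seteqP; split => t /=; rewrite !in_itv /= ?andbT => t0.
    by case: (leP t 1) => ?; [left; rewrite t0|right].
  by case: t0 => [/andP[]//|]; apply: lt_trans.
rewrite ge0_integral_setU; [|exact: measurable_itv|exact: measurable_itv
  |exact: measurable_funTS mf|by move=> t _; rewrite lee_fin; exact: f0|]; last first.
  apply/disj_setPS => t /=; rewrite !in_itv /= andbT => -[/andP[_ t1] t2]; lra.
apply: lte_add_pinfty.
  apply: (@le_lt_trans _ _ (x^-1)%:E); last exact: ltry.
  rewrite -I01; apply: ge0_le_integral.
  - exact: measurable_itv.
  - by move=> t _; rewrite lee_fin; exact: f0.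
  - exact: measurable_funTS mf.
  - exact: measurable_funTS mp.
  - move=> t /=; rewrite in_itv /= => /andP[t0 _]; rewrite lee_fin /f.
    by rewrite ler_piMr ?powR_ge0 // -expR0 ler_expR oppr_le0 ltW.
apply: (@le_lt_trans _ _ (\int[mu]_t (exponential_pdf 1 t)%:E)%E); last first.
  by rewrite integral_exponential_pdf // ltry.
apply: (@le_trans _ _ (\int[mu]_(t in `]1%R, +oo[) (exponential_pdf 1 t)%:E)%E).
  apply: ge0_le_integral.
  - exact: measurable_itv.
  - by move=> t _; rewrite lee_fin; exact: f0.
  - exact: measurable_funTS mf.
  - by apply/measurable_EFinP; apply: measurable_funTS; exact: measurable_exponential_pdf.
  - move=> t /=; rewrite in_itv /= andbT => t1; rewrite lee_fin /f.
    rewrite /exponential_pdf patchE mem_set /=; last first.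
      by rewrite in_itv /= andbT; lra.
    rewrite mul1r mulN1r ler_piMl ?expR_ge0 //.
    rewrite -[leRHS](powRr0 t); apply: ler_powR; lra.
apply: ge0_subset_integral => //.
  by apply/measurable_EFinP; exact: measurable_exponential_pdf.
by move=> t _; rewrite lee_fin exponential_pdf_ge0.
Qed.

End GammaPositive.

(** * The complex modulus *)

Section Modulus.
Variable R : realType.
Implicit Types (x y z : R[i]) (k : R).

Lemma cmod_ge0 z : 0 <= cmod z.
Proof. by rewrite /cmod; case: z => a b /=; exact: sqrtr_ge0. Qed.

Lemma cmodM x y : cmod (x * y) = cmod x * cmod y.
Proof. exact: Normc.normcM. Qed.

Lemma cmodD x y : cmod (x + y) <= cmod x + cmod y.
Proof. exact: le_normcD. Qed.

Lemma cmodN x : cmod (- x) = cmod x.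
Proof. exact: normcN. Qed.

Lemma cmod0 : cmod (0 : R[i]) = 0.
Proof. exact: Normc.normc0. Qed.

Lemma cmod_eq0 z : cmod z = 0 -> z = 0.
Proof. exact: Normc.eq0_normc. Qed.

Lemma cmod_real k : cmod k%:C = `|k|.
Proof. by rewrite /cmod /= expr0n /= addr0 sqrtr_sqr. Qed.

Lemma cmodX z n : cmod (z ^+ n) = cmod z ^+ n.
Proof.
elim: n => [|n IH]; first by rewrite !expr0 /cmod Normc.normc1.
by rewrite !exprS cmodM IH.
Qed.

Lemma cmod_nat n : cmod (n%:R : R[i]) = n%:R.
Proof. by rewrite -[n%:R](rmorph_nat (real_complex R)) cmod_real normr_nat. Qed.

Lemma cmod_sum I (r : seq I) (P : pred I) (F : I -> R[i]) :
  cmod (\sum_(i <- r | P i) F i) <= \sum_(i <- r | P i) cmod (F i).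
Proof.
elim/big_rec2: _ => [|i a b _ ab]; first by rewrite cmod0.
by apply: le_trans (cmodD _ _) _; rewrite lerD2l.
Qed.

Lemma norm_cmod z : `|z| = (cmod z)%:C.
Proof. by rewrite normc_def; case: z. Qed.

Lemma normr_Re_le z : `|complex.Re z| <= cmod z.
Proof. by have := normc_ge_Re z; rewrite norm_cmod lecR. Qed.

Lemma normr_Im_le z : `|complex.Im z| <= cmod z.
Proof.
case: z => a b; rewrite /cmod /= -sqrtr_sqr ler_sqrt ?addr_ge0 ?sqr_ge0 //.
by rewrite lerDr sqr_ge0.
Qed.

Lemma cmod_le_ReIm z : cmod z <= `|complex.Re z| + `|complex.Im z|.
Proof.
case: z => a b; rewrite /cmod /=.
rewrite -[leRHS]ger0_norm ?addr_ge0 // -sqrtr_sqr ler_sqrt ?sqr_ge0 //.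
by rewrite sqrrD !real_normK ?num_real // lerD2r lerDl mulrn_wge0 ?mulr_ge0.
Qed.

Lemma ReD x y : complex.Re (x + y) = complex.Re x + complex.Re y.
Proof. by case: x; case: y. Qed.

Lemma ImD x y : complex.Im (x + y) = complex.Im x + complex.Im y.
Proof. by case: x; case: y. Qed.

Lemma ReB x y : complex.Re (x - y) = complex.Re x - complex.Re y.
Proof. by case: x; case: y. Qed.

Lemma ImB x y : complex.Im (x - y) = complex.Im x - complex.Im y.
Proof. by case: x; case: y. Qed.

Lemma ReZ k z : complex.Re (k%:C * z) = k * complex.Re z.
Proof. by case: z => a b /=; rewrite mul0r subr0. Qed.

Lemma ImZ k z : complex.Im (k%:C * z) = k * complex.Im z.
Proof. by case: z => a b /=; rewrite mul0r addr0. Qed.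

Lemma Re_sum I (r : seq I) (P : pred I) (F : I -> R[i]) :
  complex.Re (\sum_(i <- r | P i) F i) = \sum_(i <- r | P i) complex.Re (F i).
Proof. by elim/big_rec2: _ => [//|i a b _ <-]; rewrite ReD. Qed.

Lemma Im_sum I (r : seq I) (P : pred I) (F : I -> R[i]) :
  complex.Im (\sum_(i <- r | P i) F i) = \sum_(i <- r | P i) complex.Im (F i).
Proof. by elim/big_rec2: _ => [//|i a b _ <-]; rewrite ImD. Qed.

Lemma complex_eq x y :
  complex.Re x = complex.Re y -> complex.Im x = complex.Im y -> x = y.
Proof. by case: x => a b; case: y => c d /= -> ->. Qed.

End Modulus.

(** * Series dominated by a geometric series of ratio 1/2 *)

Section DyadicSeries.
Variable R : realType.

(** Turns an estimate of partial sums, valid for every N up to a tail, into an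
    estimate of the sum. *)
Lemma le_dyadic_tail (a b K : R) : (forall N : nat, a <= b + K / 2 ^+ N) -> a <= b.
Proof.
move=> H; apply/ler_addgt0Pr => e e0.
have [K0|K0] := leP K 0.
  apply: le_trans (H 0%N) _; rewrite expr0 divr1; lra.
have [N HN] : exists N : nat, K / 2 ^+ N <= e.
  exists (Num.truncn (K / e)).+1.
  rewrite ler_pdivrMr ?exprn_gt0 // mulrC -ler_pdivrMr //.
  apply: le_trans (ltW (truncnS_gt _)) _.
  by rewrite -natrX ler_nat ltnW // ltn_expl.
by apply: le_trans (H N) _; rewrite lerD2l.
Qed.

(** The partial sums, lowered by the bound on their tails, form a
    nondecreasing sequence bounded by all the raised partial sums; its supremum
    is the sum, and the error estimate comes for free. *)
Lemma dyadic_series_real (f : nat -> R) (K : R) :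
  (forall n, `|f n| <= K / 2 ^+ n) ->
  exists s, forall N, `|s - \sum_(n < N) f n| <= 2 * K / 2 ^+ N.
Proof.
move=> fK; pose S N := \sum_(n < N) f n; pose d N : R := 2 * K / 2 ^+ N.
have dS N : d N = K / 2 ^+ N + d N.+1.
  by rewrite /d exprS; field; rewrite expf_neq0.
have K0 : 0 <= K by have := fK 0%N; rewrite expr0 divr1; apply: le_trans.
have d0 N : 0 <= d N by rewrite /d divr_ge0 ?mulr_ge0 ?exprn_ge0.
have step N : `|S N.+1 - S N| <= K / 2 ^+ N.
  by rewrite /S big_ord_recr /= addrAC subrr add0r fK.
have low N k : S N - d N <= S (N + k)%N - d (N + k)%N.
  elim: k => [|k IH]; first by rewrite addn0.
  apply: le_trans IH _; rewrite addnS (dS (N + k)%N).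
  by have := step (N + k)%N; rewrite ler_norml => /andP[+ _]; lra.
have up N k : S (N + k)%N + d (N + k)%N <= S N + d N.
  elim: k => [|k IH]; first by rewrite addn0.
  apply: le_trans IH; rewrite addnS (dS (N + k)%N).
  by have := step (N + k)%N; rewrite ler_norml => /andP[_ +]; lra.
have cross N M : S N - d N <= S M + d M.
  apply: le_trans (low N M) _; apply: le_trans (_ : S (N + M)%N + d (N + M)%N <= _).
    by have := d0 (N + M)%N; lra.
  by rewrite addnC up.
pose A := [set S N - d N | N in [set: nat]].
have A0 : A !=set0 by exists (S 0%N - d 0%N); exists 0%N.
have ubA M : ubound A (S M + d M) by move=> _ [N _ <-].
exists (sup A) => N; rewrite ler_distl; apply/andP; split.
  by apply: ub_le_sup; [exists (S N + d N); exact: ubA|exists N].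
by apply: ge_sup => //; exact: ubA.
Qed.

Lemma dyadic_series (f : nat -> R[i]) (K : R) :
  (forall n, cmod (f n) <= K / 2 ^+ n) ->
  exists s, forall N, cmod (s - \sum_(n < N) f n) <= 4 * K / 2 ^+ N.
Proof.
move=> fK.
have [a Ha] := @dyadic_series_real (fun n => complex.Re (f n)) K
  (fun n => le_trans (normr_Re_le _) (fK n)).
have [b Hb] := @dyadic_series_real (fun n => complex.Im (f n)) K
  (fun n => le_trans (normr_Im_le _) (fK n)).
exists (a +i* b) => N; apply: le_trans (cmod_le_ReIm _) _.
rewrite ReB ImB Re_sum Im_sum /=.
by apply: le_trans (lerD (Ha N) (Hb N)) _; lra.
Qed.

Lemma sum_dyadic_le (g : nat -> R) (K : R) N : (forall n, g n <= K / 2 ^+ n) ->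
  0 <= K -> \sum_(n < N) g n <= 2 * K.
Proof.
move=> gK K0; apply: (@le_trans _ _ (2 * K - 2 * K / 2 ^+ N)); last first.
  by rewrite gerBl divr_ge0 ?mulr_ge0 ?exprn_ge0.
elim: N => [|N IH]; first by rewrite big_ord0 expr0 divr1 subrr.
rewrite big_ord_recr /=; apply: le_trans (lerD IH (gK N)) _.
rewrite le_eqVlt; apply/orP; left; apply/eqP; rewrite exprS; field.
by rewrite expf_neq0.
Qed.

End DyadicSeries.

(** * Growth of recursively defined coefficients *)

Section Growth.
Variable R : realType.

Lemma exprn_le_fact_expR (y : R) (n : nat) : 0 <= y -> y ^+ n <= n`!%:R * expR y.
Proof.
move=> y0; case: n => [|n].
  by rewrite expr0 fact0 mul1r (le_trans _ (expR_ge1Dx y)) // lerDl.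
rewrite mulrC -ler_pdivrMr ?ltr0n ?fact_gt0 //.
by apply: le_trans (expR_ge1Dxn n y0); rewrite lerDr.
Qed.

Lemma powR_exprn (x s : R) n : 0 <= x -> (x ^+ n) `^ s = (x `^ s) ^+ n.
Proof.
move=> x0; elim: n => [|n IH]; first by rewrite !expr0 powR1.
by rewrite !exprS powRM ?exprn_ge0 // IH.
Qed.

(** Writing y = 2 x, y^n / (n!)^s is the s-th power of
    (y^(1/s))^n / n!, a term of the exponential series; the factor 2 is spent
    on summability in n. *)
Lemma exprn_div_fact_powR_le (s x : R) (n : nat) : 0 < s -> 0 <= x ->
  x ^+ n / (n`!%:R `^ s) <= expR (s * (2 * x) `^ s^-1) / 2 ^+ n.
Proof.
move=> s0 x0; have n0 : 0 < n`!%:R `^ s :> R by rewrite powR_gt0 // ltr0n fact_gt0.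
rewrite ler_pdivrMr // mulrAC ler_pdivlMr ?exprn_gt0 // -exprMn [x * 2]mulrC.
set y := 2 * x; have y0 : 0 <= y by rewrite mulr_ge0.
have -> : y ^+ n = ((y `^ s^-1) ^+ n) `^ s.
  by rewrite powR_exprn ?powR_ge0 // -powRrM mulVf ?gt_eqF // powRr1.
apply: le_trans (_ : (n`!%:R * expR (y `^ s^-1)) `^ s <= _).
  apply: ge0_ler_powR; rewrite ?nnegrE ?exprn_ge0 ?mulr_ge0 ?expR_ge0 ?powR_ge0 ?(ltW s0) //.
  by apply: exprn_le_fact_expR; rewrite powR_ge0.
rewrite powRM ?expR_ge0 // mulrC.
by rewrite {1}/powR (gt_eqF (expR_gt0 _)) expRK.
Qed.

Lemma fact_le_exp_fact (n k : nat) : (k <= n -> n`! <= n ^ k * (n - k)`!)%N.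
Proof.
move=> kn; rewrite -(ffact_fact kn) leq_mul2r; apply/orP; right.
elim: k {kn} => [|k IH]; first by rewrite ffactn0.
by rewrite ffactnSr expnSr leq_mul // leq_subr.
Qed.

(** The terms up to index n are final at stage n, so that the recursive
    sequence is the diagonal. *)
Fixpoint rec_prefix (T : Type) (x0 : T) (step : nat -> (nat -> T) -> T) (n : nat) :
    nat -> T :=
  if n is n'.+1 then
    fun k => if (k <= n')%N then rec_prefix x0 step n' k
             else step n' (rec_prefix x0 step n')
  else fun=> x0.

(** Course-of-values recursion: the next term may depend on all previous
    ones. *)
Lemma exists_recursive_sequence (T : Type) (x0 : T) (step : nat -> (nat -> T) -> T) :
  (forall n f g, (forall k, (k <= n)%N -> f k = g k) -> step n f = step n g) ->
  exists c : nat -> T, c 0%N = x0 /\ forall n, c n.+1 = step n c.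
Proof.
move=> stepP; pose c n := rec_prefix x0 step n n.
have cP n k : (k <= n)%N -> rec_prefix x0 step n k = c k.
  elim: n => [|n IH]; first by rewrite leqn0 => /eqP ->.
  rewrite leq_eqVlt => /predU1P[-> //|]; rewrite ltnS => kn /=.
  by rewrite kn IH.
exists c; split=> // n; rewrite {1}/c /= ltnn.
by apply: stepP => k kn; exact: cP.
Qed.

(** By strong induction.  Going from n - j to n + 1 costs
    (n + 1)! <= (n + 1)^(j + 1) (n - j)!, and raised to the power
    alpha / (m + 1) this is at most (n + 1)^alpha because j <= m: exactly what
    division by lam pays for. *)
Lemma coef_growth (alpha kappa : R) (m : nat) (a : nat -> R[i]) (lam : nat -> R)
    (c : nat -> R[i]) :
  0 < alpha -> 0 < kappa ->
  (forall n, kappa * n.+1%:R `^ alpha <= lam n.+1) ->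
  (forall n, c n.+1 = ((lam n.+1)^-1)%:C *
     \sum_(j < m.+1 | (j <= n)%N) a j * c (n - j)%N) ->
  exists2 L : R, 0 < L & forall n,
    cmod (c n) <= cmod (c 0%N) * L ^+ n / n`!%:R `^ (alpha / m.+1%:R).
Proof.
move=> al0 ka0 lamP cS; set sg := alpha / _.
pose S := \sum_(j < m.+1) cmod (a j); pose L := 1 + S / kappa.
have S0 : 0 <= S by apply: sumr_ge0 => j _; exact: cmod_ge0.
have L1 : 1 <= L by rewrite lerDl divr_ge0 // ltW.
have L0 : 0 < L by apply: lt_le_trans L1.
exists L => //; elim/ltn_ind => -[_|n IH].
  by rewrite expr0 fact0 powR1 divr1 mulr1.
have lam0 : 0 < lam n.+1 by apply: lt_le_trans (lamP n); rewrite mulr_gt0 // powR_gt0.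
rewrite cS cmodM cmod_real ger0_norm ?invr_ge0 ?(ltW lam0) //.
rewrite mulrC ler_pdivrMr //.
pose F k : R := k`!%:R `^ sg.
have F0 k : 0 < F k by rewrite powR_gt0 // ltr0n fact_gt0.
have sg0 : 0 < sg by rewrite divr_gt0.
apply: le_trans (cmod_sum _ _ _) _.
apply: le_trans (_ : \sum_(j < m.+1 | (j <= n)%N)
  cmod (a j) * (cmod (c 0%N) * L ^+ n * n.+1%:R `^ alpha / F n.+1) <= _).
  apply: ler_sum => j jn; rewrite cmodM ler_wpM2l ?cmod_ge0 //.
  apply: le_trans (IH (n - j)%N _) _; first by rewrite ltnS leq_subr.
  rewrite -!mulrA ler_wpM2l ?cmod_ge0 //.
  apply: ler_pM; rewrite ?exprn_ge0 ?(ltW L0) ?invr_ge0 ?powR_ge0 //.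
    by apply: ler_weXn2l => //; exact: leq_subr.
  rewrite -/(F _) ler_pdivlMr // mulrC ler_pdivrMr //.
  have -> : alpha = m.+1%:R * sg by rewrite /sg mulrC divfK // pnatr_eq0.
  rewrite powRrM powR_mulrn // -powRM ?exprn_ge0 //.
  apply: ge0_ler_powR; rewrite ?nnegrE ?mulr_ge0 ?exprn_ge0 ?(ltW sg0) ?(ltW al0) //.
  rewrite -natrX -natrM ler_nat.
  apply: leq_trans (fact_le_exp_fact (n := n.+1) (k := j.+1) _) _; first by rewrite ltnS.
  by rewrite subSS leq_mul2r leq_pexp2l ?orbT // ltn_ord.
rewrite -mulr_suml; set Q := _ / F n.+1.
have Q0 : 0 <= Q.
  by rewrite /Q divr_ge0 ?mulr_ge0 ?cmod_ge0 ?exprn_ge0 ?powR_ge0 // ltW.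
apply: le_trans (_ : S * Q <= _).
  rewrite ler_wpM2r // /S [leRHS](bigID (fun j : 'I_m.+1 => (j <= n)%N)) /= lerDl.
  by apply: sumr_ge0 => j _; exact: cmod_ge0.
apply: le_trans (_ : (kappa * L) * Q <= _).
  rewrite ler_wpM2r // /L mulrDr mulr1 mulrCA divff ?gt_eqF // mulr1 lerDr ltW //.
have -> : kappa * L * Q = cmod (c 0%N) * L ^+ n.+1 / F n.+1 * (kappa * n.+1%:R `^ alpha).
  by rewrite /Q exprS; ring.
apply: ler_wpM2l (lamP n).
by rewrite divr_ge0 ?mulr_ge0 ?cmod_ge0 ?exprn_ge0 // ltW.
Qed.

End Growth.

(** * Entire functions as everywhere convergent power series *)

Section EntireSeries.
Variable R : realType.
Variables (c : nat -> R[i]) (E : R -> R).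
Hypothesis cE : forall (x : R) n, 0 <= x -> cmod (c n) * x ^+ n <= E x / 2 ^+ n.

(** v is the sum of the power series with coefficients c, in the quantitative
    form that is used throughout: the error of the partial sums is controlled by
    the same E that dominates the coefficients. *)
Definition is_series_sum (v : R[i] -> R[i]) := forall z N,
  cmod (v z - \sum_(n < N) c n * z ^+ n) <= 4 * E (cmod z) / 2 ^+ N.

Lemma exists_series_sum : exists v, is_series_sum v.
Proof.
have /choice[v vP] : forall z : R[i], exists s, forall N,
    cmod (s - \sum_(n < N) c n * z ^+ n) <= 4 * E (cmod z) / 2 ^+ N.
  by move=> z; apply: (@dyadic_series _ (fun n => c n * z ^+ n) (E (cmod z))) => n; rewrite cmodM cmodX cE // cmod_ge0.
by exists v.
Qed.

Lemma series_bound_ge0 x : 0 <= x -> 0 <= E x.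
Proof.
move=> x0; have := cE 0 x0; rewrite !expr0 divr1 mulr1.
by apply: le_trans; exact: cmod_ge0.
Qed.

Lemma series_sum_le v z : is_series_sum v -> cmod (v z) <= 4 * E (cmod z).
Proof. by move=> vP; have := vP z 0%N; rewrite big_ord0 subr0 expr0 divr1. Qed.

Lemma series_sum0 v : is_series_sum v -> v 0 = c 0%N.
Proof.
move=> vP; apply/eqP; rewrite -subr_eq0; apply/eqP/cmod_eq0/eqP.
rewrite eq_le cmod_ge0 andbT.
apply: (@le_dyadic_tail _ _ _ (2 * E 0)) => N; rewrite add0r.
have := vP 0 N.+1; rewrite big_ord_recl expr0 mulr1 big1 => [|i _].
  by rewrite addr0 cmod0 exprS => /le_trans; apply; rewrite le_eqVlt; apply/orP;
    left; apply/eqP; field; rewrite expf_neq0.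
by rewrite /= expr0n mulr0.
Qed.

(** The inequality is proved with the generous base |z| + 2 because it is then
    stable under the recursion
    d_(n+1) = (z + h) d_n + n z^(n-1) h^2 for the remainders d_n. *)
Lemma taylor_remainder_le (z h : R[i]) n : cmod h <= 1 ->
  cmod ((z + h) ^+ n - z ^+ n - h * (n%:R * z ^+ n.-1)) <=
  cmod h ^+ 2 * (cmod z + 2) ^+ n.
Proof.
move=> h1; have z0 := cmod_ge0 z; have h0 := cmod_ge0 h.
elim: n => [|n IH].
  by rewrite !expr0 subrr mul0r mulr0 subr0 cmod0 mulr1 exprn_ge0.
have -> : (z + h) ^+ n.+1 - z ^+ n.+1 - h * (n.+1%:R * z ^+ n) =
  (z + h) * ((z + h) ^+ n - z ^+ n - h * (n%:R * z ^+ n.-1)) +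
  h ^+ 2 * (n%:R * z ^+ n.-1).
  case: n {IH} => [|n]; first by rewrite !expr0 !expr1; ring.
  by rewrite -[n.+1.-1]/n [n.+2%:R]mulrSr !exprS; ring.
apply: le_trans (cmodD _ _) _; rewrite !cmodM !cmodX cmod_nat -expr2.
have dn : n%:R * cmod z ^+ n.-1 <= (cmod z + 2) ^+ n.
  elim: n {IH} => [|n IH]; first by rewrite mul0r expr0.
  rewrite -[n.+1.-1]/n [leRHS]exprS mulrSr mulrDl mul1r.
  have -> : n%:R * cmod z ^+ n = cmod z * (n%:R * cmod z ^+ n.-1).
    by case: n {IH} => [|n]; [rewrite !mul0r mulr0|rewrite -[n.+1.-1]/n exprS; ring].
  have : cmod z ^+ n <= (cmod z + 2) ^+ n by rewrite lerXn2r ?nnegrE //; lra.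
  have : 0 <= (cmod z + 2) ^+ n by rewrite exprn_ge0 //; lra.
  nra.
apply: le_trans (_ : (cmod z + 1) * (cmod h ^+ 2 * (cmod z + 2) ^+ n) +
   cmod h ^+ 2 * (cmod z + 2) ^+ n <= _); last first.
  by rewrite [_ ^+ n.+1]exprS le_eqVlt; apply/orP; left; apply/eqP; ring.
apply: lerD; last by rewrite ler_wpM2l // exprn_ge0.
apply: ler_pM; rewrite ?cmod_ge0 //.
by apply: le_trans (cmodD _ _) _; rewrite lerD2l.
Qed.

(** The derivative is the termwise one; its series is dominated at radius
    2 (|z| + 1) since n <= 2^n.  Termwise remainders are summed at radius
    |z| + 2, which makes the error quadratic in h. *)
Lemma series_sum_taylor v : is_series_sum v ->
  exists D : R[i] -> R[i], forall z h, cmod h <= 1 ->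
  cmod (v (z + h) - v z - h * D z) <= 2 * E (cmod z + 2) * cmod h ^+ 2.
Proof.
move=> vP.
have bound (z : R[i]) n :
    cmod (c n * (n%:R * z ^+ n.-1)) <= E (2 * (cmod z + 1)) / 2 ^+ n.
  have z0 := cmod_ge0 z.
  rewrite !cmodM cmod_nat cmodX.
  apply: le_trans (cE n (_ : 0 <= 2 * (cmod z + 1))); last lra.
  rewrite ler_wpM2l ?cmod_ge0 // exprMn; apply: ler_pM => //.
  - by rewrite exprn_ge0.
  - by rewrite -natrX ler_nat ltnW // ltn_expl.
  - case: n => [|n]; first by rewrite !expr0.
    rewrite -[n.+1.-1]/n exprS; have : cmod z ^+ n <= (cmod z + 1) ^+ n.
      by rewrite lerXn2r ?nnegrE //; lra.
    have : 0 <= (cmod z + 1) ^+ n by rewrite exprn_ge0 //; lra.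
    nra.
have /choice[D DP] : forall z : R[i], exists s, forall N,
    cmod (s - \sum_(n < N) c n * (n%:R * z ^+ n.-1)) <=
      4 * E (2 * (cmod z + 1)) / 2 ^+ N.
  by move=> z; exact: (@dyadic_series _ (fun n => c n * (n%:R * z ^+ n.-1)) _ (bound z)).
exists D => z h h1.
have z0 := cmod_ge0 z.
pose K := 4 * E (cmod (z + h)) + 4 * E (cmod z) + 4 * E (2 * (cmod z + 1)).
apply: (@le_dyadic_tail _ _ _ K) => N.
pose A := v (z + h) - \sum_(n < N) c n * (z + h) ^+ n.
pose B := v z - \sum_(n < N) c n * z ^+ n.
pose G := D z - \sum_(n < N) c n * (n%:R * z ^+ n.-1).
pose Q := \sum_(n < N) c n * ((z + h) ^+ n - z ^+ n - h * (n%:R * z ^+ n.-1)).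
have -> : v (z + h) - v z - h * D z = Q + (A - B - h * G).
  have -> : Q = \sum_(n < N) c n * (z + h) ^+ n - \sum_(n < N) c n * z ^+ n
     - h * \sum_(n < N) c n * (n%:R * z ^+ n.-1).
    by rewrite mulr_sumr -!sumrB; apply: eq_bigr => n _; ring.
  by rewrite /A /B /G; ring.
apply: le_trans (cmodD _ _) _; apply: lerD.
  apply: le_trans (cmod_sum _ _ _) _.
  apply: le_trans (_ : \sum_(n < N) cmod h ^+ 2 * (cmod (c n) * (cmod z + 2) ^+ n) <= _).
    apply: ler_sum => n _; rewrite cmodM [leRHS]mulrCA ler_wpM2l ?cmod_ge0 //.
    exact: taylor_remainder_le.
  rewrite -mulr_sumr mulrC ler_wpM2r ?exprn_ge0 ?cmod_ge0 //.
  apply: (@sum_dyadic_le _ (fun n => cmod (c n) * (cmod z + 2) ^+ n)).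
    by move=> n; apply: cE; lra.
  by apply: series_bound_ge0; lra.
apply: le_trans (cmodD _ _) _; rewrite cmodN cmodM.
have hA := vP (z + h) N; have hB := vP z N; have hG := DP z N.
rewrite -/A in hA; rewrite -/B in hB; rewrite -/G in hG.
have hAB : cmod (A - B) <= cmod A + cmod B by rewrite -(cmodN B) cmodD.
have hG' : cmod h * cmod G <= cmod G by rewrite ler_piMl ?cmod_ge0.
rewrite /K 2!mulrDl; apply: le_trans (lerD hAB hG') _.
by apply: lerD hG; apply: lerD.
Qed.

Lemma series_sum_entire v : is_series_sum v -> entire v.
Proof.
move=> vP z; have [D DP] := series_sum_taylor vP.
apply/cvg_ex; exists (D z).
apply/cvgrPdist_le => /= e e0.
have [k k0 ke] : exists2 k : R, 0 < k & e = k%:C.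
  move: e0; rewrite ltcE /= => /andP[/eqP eI eR].
  by exists (complex.Re e) => //; apply: complex_eq.
pose M := 2 * E (cmod z + 2); pose d := Num.min 1 (k / (M + 1)).
have M0 : 0 <= M by rewrite mulr_ge0 // series_bound_ge0 //; have := cmod_ge0 z; lra.
have d0 : 0 < d by rewrite lt_min ltr01 divr_gt0 //; lra.
near=> h.
have h0 : h != 0 by near: h; exact: (@nbhs_dnbhs_neq (Cplx R) 0).
have hd : cmod h < d.
  have : `|h| < d%:C by near: h; apply: (@dnbhs0_lt (Cplx R) (Cplx R)^o); rewrite ltcR.
  by rewrite norm_cmod ltcR.
have ch0 : 0 < cmod h.
  by rewrite lt_neqAle cmod_ge0 andbT eq_sym; apply: contra h0 => /eqP/cmod_eq0 ->.
rewrite ke norm_cmod lecR.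
have -> : D z - h^-1 *: (v (h%:A + z) - v z) = - (h^-1 * (v (z + h) - v z - h * D z)).
  rewrite /GRing.scale /= mulr1 [h + z]addrC; field; exact: h0.
rewrite cmodN cmodM [cmod h^-1]Normc.normcV mulrC -/(cmod h) ler_pdivrMr //.
move: hd; rewrite lt_min => /andP[/ltW h1 hk].
apply: le_trans (DP z h h1) _; rewrite -/M expr2 mulrA ler_wpM2r ?cmod_ge0 //.
move: hk; rewrite ltr_pdivlMr; last lra.
by have := cmod_ge0 h; nra.
Unshelve. all: by end_near. Qed.

End EntireSeries.

(** * Order of an entire function of exponential-power growth *)

Section Order.
Variable R : realType.

Lemma max_modulus_le (v : R[i] -> R[i]) (r B : R) : 0 <= r ->
  (forall z, cmod z = r -> cmod (v z) <= B) -> max_modulus v r <= B.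
Proof.
move=> r0 vB; apply: ge_sup.
  have rE : cmod r%:C = r by rewrite cmod_real ger0_norm.
  by exists (cmod (v r%:C)), r%:C.
by move=> _ [z /= zr <-]; exact: vB.
Qed.

(** For r > 1 the maximum modulus M(r) satisfies ln M(r) <= C' r^rho, hence
    ln (ln M(r)) <= ln C' + rho ln r, where ln C' is negligible against ln r.
    Small values of M(r) do no harm: ln is 0 outside of the positive reals, so
    ln (ln M(r)) = 0 whenever ln M(r) <= 0. *)
Lemma entire_order_le (v : R[i] -> R[i]) (C k rho : R) :
  0 <= C -> 0 < k -> 0 < rho ->
  (forall z, cmod (v z) <= C * expR (k * cmod z `^ rho)) ->
  (entire_order v <= rho%:E)%E.
Proof.
move=> C0 k0 rho0 vB; rewrite /entire_order; case: asboolP => _.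
  by rewrite lee_fin ltW.
pose C' := 1 + ln (1 + C) + k.
have lnC : 0 <= ln (1 + C) by rewrite ln_ge0 // lerDl.
have C'1 : 1 <= C' by rewrite /C'; lra.
have lnC' : 0 <= ln C' by rewrite ln_ge0.
have key r : 1 < r -> ln (ln (max_modulus v r)) <= ln C' + rho * ln r.
  move=> r1; have lr0 : 0 < ln r by rewrite ln_gt0.
  have r0 : 0 < r by lra.
  have rhs0 : 0 <= ln C' + rho * ln r by rewrite addr_ge0 // mulr_ge0 // ltW.
  set M := max_modulus v r.
  have [lM|lM] := leP (ln M) 0; first by rewrite ln0.
  have M0 : 0 < M by rewrite ltNge; apply/negP => /ln0 E; rewrite E ltxx in lM.
  have MB : M <= (1 + C) * expR (k * r `^ rho).
    apply: max_modulus_le => [|z zr]; first exact: ltW.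
    apply: le_trans (vB z) _; rewrite zr ler_wpM2r ?expR_ge0 //; lra.
  have rr : 1 <= r `^ rho.
    by rewrite -[leLHS](powRr0 r); apply: ler_powR; lra.
  have lMB : ln M <= C' * r `^ rho.
    apply: le_trans (_ : ln (1 + C) + k * r `^ rho <= _); last first.
      by rewrite /C'; nra.
    rewrite -[X in _ + X]expRK -lnM ?posrE ?expR_gt0; [|lra..].
    by rewrite ler_ln ?posrE // mulr_gt0 ?expR_gt0 //; lra.
  rewrite -ln_powR -lnM ?posrE ?powR_gt0 //; last lra.
  by rewrite ler_ln ?posrE // mulr_gt0 ?powR_gt0 //; lra.
rewrite limf_esupE; apply/lee_addgt0Pr => e e0.
pose r0 : R := Num.max 2 (expR (ln C' / e)).
apply: (@le_trans _ _ (ereal_sup ((fun r : R =>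
    (ln (ln (max_modulus v r)) / ln r)%:E) @` `]r0, +oo[%classic))).
  apply: ereal_inf_lbound; exists `]r0, +oo[%classic => //.
  by exists r0; split; [exact: num_real|move=> x /= xr; rewrite in_itv /= xr].
apply: ge_ereal_sup => _ [r /= + <-]; rewrite in_itv /= andbT gt_max => /andP[r2 re].
have r1 : 1 < r by lra.
have lr0 : 0 < ln r by rewrite ln_gt0.
rewrite -EFinD lee_fin ler_pdivrMr //; apply: le_trans (key r r1) _.
rewrite mulrDl addrC lerD2l mulrC -ler_pdivrMr //.
by rewrite -[leLHS]expRK ler_ln ?posrE ?expR_gt0 ?(ltW re) //; lra.
Qed.

End Order.

(** * Integration against an integrable weight *)

Section WeightedIntegrals.
Context d (T : measurableType d) (R : realType) (nu : {measure set T -> \bar R}).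
Variables (D : set T) (mD : measurable D) (w : T -> R).
Hypothesis iw : nu.-integrable D (EFin \o w).

Lemma integrable_weight (f : T -> R) (M : R) : measurable_fun D f ->
  (forall x, D x -> `|f x| <= M) ->
  nu.-integrable D (EFin \o (fun x => w x * f x)).
Proof.
move=> mf fM.
apply: (@le_integrable _ _ _ nu _ mD _ (EFin \o (fun x => M * w x))).
- apply/measurable_EFinP; apply: measurable_funM => //.
  by apply/measurable_EFinP; apply: measurable_int iw.
- move=> x Dx; rewrite lee_fin !normrM mulrC ler_wpM2r //.
  by apply: le_trans (fM x Dx) _; exact: ler_norm.
- exact: integrableZl_EFin.
Qed.

Lemma weighted_Rintegral_le (f : T -> R) (M : R) : measurable_fun D f ->
  (forall x, D x -> 0 <= w x) -> (forall x, D x -> `|f x| <= M) ->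
  `|\int[nu]_(x in D) (w x * f x)| <= M * \int[nu]_(x in D) w x.
Proof.
move=> mf w0 fM; have iwf := integrable_weight mf fM.
apply: le_trans (le_normr_Rintegral mD iwf) _.
rewrite -RintegralZl //; apply: le_Rintegral => //.
- exact: integrable_norm.
- exact: integrableZl_EFin.
- by move=> x Dx; rewrite normrM (ger0_norm (w0 x Dx)) mulrC ler_wpM2r ?w0 ?fM.
Qed.

End WeightedIntegrals.

(** Integrability is proved along with the equality, as the induction needs
    it. *)
Lemma Rintegral_sum d (T : measurableType d) (R : realType)
    (nu : {measure set T -> \bar R}) (D : set T) (g : nat -> T -> R) (N : nat) :
  measurable D -> (forall n, nu.-integrable D (EFin \o g n)) ->
  nu.-integrable D (EFin \o (fun x => \sum_(n < N) g n x)) /\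
  \int[nu]_(x in D) (\sum_(n < N) g n x) = \sum_(n < N) \int[nu]_(x in D) g n x.
Proof.
move=> mD ig; elim: N => [|N [iN eN]].
  have E : (fun x => \sum_(n < 0) g n x) = cst 0 by apply/funext => x; rewrite big_ord0.
  rewrite E big_ord0; split; last by rewrite Rintegral_cst // mul0r.
  exact: integrable0.
have E : (fun x => \sum_(n < N.+1) g n x) = (fun x => \sum_(n < N) g n x + g N x).
  by apply/funext => x; rewrite big_ord_recr.
rewrite E big_ord_recr /= RintegralD // eN; split => //.
exact: integrableD_EFin.
Qed.

(** * The Riemann-Liouville integral of a monomial *)

Section MonomialIntegrals.
Variables (R : realType) (alpha : R).
Hypotheses (alpha_gt0 : 0 < alpha) (alpha_lt1 : alpha < 1).
Notation mu := (@lebesgue_measure R).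

Let oma0 : 0 < 1 - alpha. Proof. by rewrite subr_gt0. Qed.

Let expo_gt0 n : 0 < alpha * n%:R + 1 - alpha.
Proof. by rewrite -addrA ltr_wpDl // mulr_ge0 // ltW. Qed.

(** The Caputo derivative maps t^(alpha n) to RL_symbol n t^(alpha (n - 1)) for
    n >= 1; for n = 0 this is the coefficient of the term t^(-alpha) that the
    Riemann-Liouville derivative of the constant 1 produces. *)
Definition RL_symbol (n : nat) : R :=
  Beta (1 - alpha) (alpha * n%:R + 1) * (alpha * n%:R + 1 - alpha) / Gamma (1 - alpha).

Lemma Gamma_oma_gt0 : 0 < Gamma (1 - alpha).
Proof. by apply: Gamma_gt0; rewrite oma0 gerBl ltW. Qed.

Lemma RL_symbol0 : RL_symbol 0 = (Gamma (1 - alpha))^-1.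
Proof.
rewrite /RL_symbol mulr0 add0r; suff -> : Beta (1 - alpha) 1 = (1 - alpha)^-1.
  by rewrite mulVf ?mul1r // gt_eqF.
apply: EFin_inj; rewrite EFin_Beta //.
have := @integral_powR_sub R (1 - alpha) 0 1 oma0 ler01; rewrite subr0 powR1 div1r => <-.
by apply: eq_integral => s _; rewrite /beta_kernel subrr powRr0 mulr1.
Qed.

(** On the window [p, 1] with p = n / (n + 1), s^(alpha n) >= p^n >= 1/e, so
    the Beta integral is at least a constant times (n + 1)^(alpha - 1). *)
Lemma RL_symbol_ge : exists2 kappa : R, 0 < kappa &
  forall n, kappa * n.+1%:R `^ alpha <= RL_symbol n.+1.
Proof.
have [[al0 al1] G0] := (alpha_gt0, alpha_lt1, Gamma_oma_gt0).
exists (expR (- 1) / (1 - alpha) * (alpha / 2) / Gamma (1 - alpha)) => [|n].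
  by rewrite divr_gt0 // mulr_gt0 ?divr_gt0 ?expR_gt0 // ltr0n.
set N := n.+1; have N0 : 0 < N%:R :> R by rewrite ltr0n.
have N1 : 0 < N%:R + 1 :> R by lra.
pose p : R := N%:R / (N%:R + 1).
have p0 : 0 < p by rewrite divr_gt0.
have p1 : p <= 1 by rewrite ler_pdivrMr // mul1r; lra.
have omp : 1 - p = (N%:R + 1)^-1 by rewrite /p; field; lra.
have pN : expR (- 1) <= p `^ N%:R.
  rewrite powR_mulrn ?(ltW p0) // expRN -lef_pV2 ?posrE ?invr_gt0 ?exprn_gt0 ?expR_gt0 //.
  rewrite invrK -exprVn.
  have -> : p^-1 = 1 + N%:R^-1 by rewrite /p; field; lra.
  apply: le_trans (_ : expR (N%:R^-1) ^+ N <= _).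
    by rewrite lerXn2r ?nnegrE ?expR_ge0 ?expR_ge1Dx // addr_ge0 // invr_ge0 ltW.
  by rewrite -expRM_natl divff // gt_eqF.
have b0 : 0 < alpha * N%:R + 1 by rewrite ltr_wpDl // mulr_ge0 // ltW.
have B : expR (- 1) * ((1 - p) `^ (1 - alpha) / (1 - alpha)) <=
    Beta (1 - alpha) (alpha * N%:R + 1).
  have p01 : 0 <= p <= 1 by rewrite p1 ltW.
  apply: (Beta_ge oma0 b0 p01 (expR_ge0 _)).
  move=> s /andP[ps s1]; rewrite addrK.
  have s0 : 0 < s by apply: lt_le_trans ps.
  apply: le_trans pN _; apply: le_trans (_ : s `^ N%:R <= _).
    by apply: ge0_ler_powR; rewrite ?nnegrE ?(ltW p0) ?(ltW s0) ?(ltW N0).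
  by apply: ger_powR; [rewrite s0|rewrite ler_piMl ?(ltW N0) ?(ltW alpha_lt1)].
rewrite omp in B.
have E : alpha / 2 * (N%:R + 1) <= alpha * N%:R + 1 - alpha.
  have : 1 <= N%:R :> R by rewrite ler1n.
  nra.
rewrite /RL_symbol -/N mulrAC ler_pM2r ?invr_gt0 //.
apply: le_trans (_ : expR (- 1) * ((N%:R + 1)^-1 `^ (1 - alpha) / (1 - alpha)) *
   (alpha / 2 * (N%:R + 1)) <= _); last first.
  apply: ler_pM => //; rewrite ?mulr_ge0 ?expR_ge0 ?powR_ge0 ?invr_ge0 ?(ltW oma0) //;
  by rewrite ?(ltW alpha_gt0) ?(ltW N1).
have -> : (N%:R + 1 : R)^-1 `^ (1 - alpha) = (N%:R + 1) `^ alpha / (N%:R + 1).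
  rewrite -[(N%:R + 1)^-1 in LHS]powR_inv1 ?(ltW N1) // -powRrM mulN1r opprB.
  by rewrite powRB ?powRr1 ?(ltW N1) // (gt_eqF N1) implybT.
have -> : expR (- 1) * ((N%:R + 1) `^ alpha / (N%:R + 1) / (1 - alpha)) *
   (alpha / 2 * (N%:R + 1)) = expR (- 1) / (1 - alpha) * (alpha / 2) * (N%:R + 1) `^ alpha.
  by field; rewrite !gt_eqF.
rewrite ler_wpM2l ?mulr_ge0 ?expR_ge0 ?invr_ge0 ?(ltW oma0) ?(ltW alpha_gt0) //.
by apply: ge0_ler_powR; rewrite ?nnegrE; lra.
Qed.

Lemma integrable_powRN t : 0 <= t ->
  mu.-integrable `[0, t] (EFin \o (fun s : R => s `^ (- alpha))).
Proof.
move=> t0; have -> : - alpha = (1 - alpha) - 1 by ring.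
exact: integrable_powR.
Qed.

Lemma integrable_powRN_sub p t : p <= t ->
  mu.-integrable `[p, t] (EFin \o (fun s : R => (t - s) `^ (- alpha))).
Proof.
move=> t0; have -> : - alpha = (1 - alpha) - 1 by ring.
exact: integrable_powR_sub.
Qed.

Lemma integrable_weight_monomial (w : R -> R) t n : 0 <= t ->
  mu.-integrable `[0, t] (EFin \o w) ->
  mu.-integrable `[0, t] (EFin \o (fun s : R => w s * (s `^ alpha) ^+ n)).
Proof.
move=> t0 iw; apply: (integrable_weight _ iw (M := (t `^ alpha) ^+ n)) => //.
  by apply: measurable_funTS; apply: measurable_funX; exact: measurable_powR.
move=> s /=; rewrite in_itv /= => /andP[s0 st].
rewrite ger0_norm ?exprn_ge0 ?powR_ge0 // lerXn2r ?nnegrE ?powR_ge0 //.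
by apply: ge0_ler_powR; rewrite ?nnegrE ?(ltW alpha_gt0).
Qed.

(** Both integrals are multiples of t^(alpha n + 1 - alpha).  Comparing them
    with each other, instead of evaluating the left-hand side, gives the
    Riemann-Liouville integral the form of an indefinite integral. *)
Lemma RL_monomial (t : R) n : 0 < t ->
  \int[mu]_(s in `[0, t]) ((t - s) `^ (- alpha) * (s `^ alpha) ^+ n) =
  Gamma (1 - alpha) * RL_symbol n *
    \int[mu]_(s in `[0, t]) (s `^ (- alpha) * (s `^ alpha) ^+ n).
Proof.
move=> t0; have [[al0 al1] G0] := (alpha_gt0, alpha_lt1, Gamma_oma_gt0); have e0 := expo_gt0 n.
have b0 : 0 < alpha * n%:R + 1 by rewrite ltr_wpDl // mulr_ge0 // ltW.
have -> : \int[mu]_(s in `[0, t]) (s `^ (- alpha) * (s `^ alpha) ^+ n) =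
    t `^ (alpha * n%:R + 1 - alpha) / (alpha * n%:R + 1 - alpha).
  rewrite -Rintegral_itv_obnd_cbnd; last first.
    apply: (integrableS _ _ _
      (integrable_weight_monomial n (ltW t0) (integrable_powRN (ltW t0)))) => //.
    exact: subset_itv_oc_cc.
  rewrite /Rintegral; transitivity (fine (\int[mu]_(s in `]0%R, t])
     (s `^ ((alpha * n%:R + 1 - alpha) - 1))%:E)%E).
    congr fine; apply: eq_integral => s; rewrite inE /= in_itv /= => /andP[s0 _].
    rewrite -powR_mulrn ?powR_ge0 // -powRrM -powRD; last by rewrite (gt_eqF s0) implybT.
    by congr (_ `^ _)%:E; ring.
  rewrite integral_itv_obnd_cbnd; last first.
    by apply/measurable_EFinP; apply: measurable_funTS; exact: measurable_powR.
  by rewrite integral_powR // ltW.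
have -> : \int[mu]_(s in `[0, t]) ((t - s) `^ (- alpha) * (s `^ alpha) ^+ n) =
    t `^ (alpha * n%:R + 1 - alpha) * Beta (1 - alpha) (alpha * n%:R + 1).
  rewrite /Rintegral; transitivity (fine (\int[mu]_(s in `[0%R, t])
     ((t - s) `^ ((1 - alpha) - 1) * (s - 0) `^ (alpha * n%:R + 1 - 1))%:E)%E).
    congr fine; apply: eq_integral => s _; rewrite subr0 addrK.
    rewrite -powR_mulrn ?powR_ge0 // -powRrM.
    by congr (_ `^ _ * _)%:E; ring.
  rewrite integral_beta_scale // -EFin_Beta // -EFinM /= subr0.
  by congr (_ `^ _ * _); ring.
by rewrite /RL_symbol; field; rewrite !gt_eqF.
Qed.

End MonomialIntegrals.

(** * Indefinite integrals are absolutely continuous *)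

Section IndefiniteIntegral.
Variable R : realType.
Notation mu := (@lebesgue_measure R).

Lemma measure_bigsetU_itv (n : nat) (x y : 'I_n -> R) :
  (forall i, x i <= y i) -> trivIset setT (fun i => [set` `]x i, y i[]) ->
  mu (\big[setU/set0]_(i <- enum 'I_n) `]x i, y i[%classic) =
  (\sum_(i < n) (y i - x i))%:E.
Proof.
move=> xy tI; set D := \big[setU/set0]_(_ <- _) _.
have mD : measurable D by apply: bigsetU_measurable => i _; exact: measurable_itv.
have -> : mu D = (\int[mu]_(s in D) 1%:E)%E by rewrite integral_cst // mul1e.
rewrite ge0_integral_bigsetU ?enum_uniq //; last first.
  by apply: sub_trivIset tI.
rewrite big_enum /= -sumEFin; apply: eq_bigr => i _.
rewrite integral_cst; last exact: measurable_itv.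
rewrite mul1e; apply: etrans (lebesgue_measure_itv _) _; rewrite /= lte_fin lt_neqAle xy andbT.
by case: eqP => [->|_] //=; rewrite subrr.
Qed.

Lemma Rintegral_diff_le (g : R -> R) (T x y : R) :
  mu.-integrable `[0, T] (EFin \o g) -> 0 <= x -> x <= y -> y <= T ->
  `|\int[mu]_(s in `[0, y]) g s - \int[mu]_(s in `[0, x]) g s| <=
  \int[mu]_(s in `]x, y[) `|g s|.
Proof.
move=> ig x0 xy yT.
have iy : mu.-integrable `[0, y] (EFin \o g).
  by apply: integrableS ig => //; apply: subset_itvl; rewrite bnd_simp.
have ixy : mu.-integrable `]x, y[ (EFin \o g).
  apply: integrableS iy => //; apply: subset_itvW; rewrite ?bnd_simp //.
rewrite Rintegral_itvB ?bnd_simp // -Rintegral_itv_bndo_bndc; last exact: ixy.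
by apply: le_normr_Rintegral.
Qed.

(** Absolute continuity of the Lebesgue integral of |f| + |g|, applied to the
    union of the given intervals. *)
Lemma abs_continuous_indefinite (f g : R -> R) (T : R) (G : R -> R[i]) :
  mu.-integrable `[0, T] (EFin \o f) -> mu.-integrable `[0, T] (EFin \o g) ->
  (forall t, G t = (\int[mu]_(s in `[0, t]) f s) +i* (\int[mu]_(s in `[0, t]) g s)) ->
  abs_continuous 0 T G.
Proof.
move=> i1 i2 GE e e0.
pose h := (fun s => `|f s| + `|g s|) \_ `[0, T].
have ih0 : mu.-integrable `[0, T] (EFin \o (fun s => `|f s| + `|g s|)).
  by apply: integrableD_EFin => //; apply: integrable_norm.
have ih : mu.-integrable setT (EFin \o h).
  by rewrite /h -restrict_EFin; apply/integrable_restrict => //=; rewrite setTI.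
have [d [d0 dP]] := integral_normr_continuous ih e0.
exists d => // n x y xy tI sd.
pose D := \big[setU/set0]_(i <- enum 'I_n) `]x i, y i[%classic.
have mD : measurable D by apply: bigsetU_measurable => i _; exact: measurable_itv.
have sub i : `]x i, y i[%classic `<=` `[0, T]%classic.
  have [a0 [_ bT]] := xy i.
  move=> s /=; rewrite !in_itv /= => /andP[xs sy].
  by rewrite (le_trans a0 (ltW xs)) (le_trans (ltW sy) bT).
apply: le_lt_trans (dP D mD _); last first.
  have mDE := measure_bigsetU_itv (fun i => (xy i).2.1) tI.
  by apply: le_lt_trans (_ : (\sum_(i < n) (y i - x i))%:E < _)%E; rewrite ?lte_fin // -mDE.
have nh : mu.-integrable D (EFin \o (fun s => `|h s|)).
  by apply: integrable_norm => //; apply: integrableS ih.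
rewrite -lee_fin /Rintegral fineK; last exact: integrable_fin_num nh.
rewrite ge0_integral_bigsetU ?enum_uniq //; last 2 first.
- by apply: sub_trivIset tI.
- exact: measurable_int nh.
rewrite big_enum /= -sumEFin; apply: lee_sum => i _.
have [x0 [xyi yT]] := xy i.
have jf : mu.-integrable `]x i, y i[ (EFin \o f) by apply: integrableS i1.
have jg : mu.-integrable `]x i, y i[ (EFin \o g) by apply: integrableS i2.
have jn : mu.-integrable `]x i, y i[ (EFin \o (fun s => `|f s|)) by apply: integrable_norm.
have kn : mu.-integrable `]x i, y i[ (EFin \o (fun s => `|g s|)) by apply: integrable_norm.
apply: (@le_trans _ _ (\int[mu]_(s in `]x i, y i[) (`|f s| + `|g s|)%R)%:E).
  rewrite lee_fin RintegralD //; apply: le_trans (cmod_le_ReIm _) _.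
  by rewrite ReB ImB !GE /=; apply: lerD; exact: Rintegral_diff_le yT.
rewrite fineK; last first.
  by apply: integrable_fin_num => //; exact: integrableD_EFin.
rewrite le_eqVlt; apply/orP; left; apply/eqP; apply: eq_integral => s.
rewrite inE => si; rewrite /h /= patchE mem_set; last exact: sub si.
by congr EFin; apply/esym/ger0_norm; rewrite addr_ge0.
Qed.

End IndefiniteIntegral.

(** * Continuity of complex-valued functions *)

Section ComplexContinuity.
Variable R : realType.

Lemma continuous_real_complex : continuous (fun x : R => x%:C : Cplx R).
Proof.
move=> x; apply/cvgrPdist_lt => /= e; rewrite ltcE /= => /andP[/eqP eI eR].
have -> : e = (complex.Re e)%:C by apply: complex_eq.
near=> y.
rewrite -rmorphB /= norm_cmod ltcR cmod_real.
by near: y; apply: (@cvgr_dist_lt R R^o).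
Unshelve. all: by end_near. Qed.

(** The norm of R[i] takes its values in R[i]; this restates its topology with
    real radii. *)
Lemma near_cmod (z : Cplx R) (e : R) : 0 < e -> \forall y \near z, cmod (z - y) < e.
Proof.
move=> e0; have e0' : 0 < e%:C :> Cplx R by rewrite ltcR.
have H : \forall y \near z, `|z - y| < (e%:C : Cplx R).
  exact: (@nbhsx_ballx (Cplx R) (Cplx R) z _ e0').
by apply: filterS H => y; rewrite norm_cmod ltcR.
Qed.

Lemma continuous_Re : continuous (fun z : Cplx R => complex.Re z : R).
Proof.
move=> z; apply: (proj2 (@cvgrPdist_lt _ R^o _ (nbhs z) _ _ _)) => e e0.
apply: filterS (near_cmod z e0) => y ye; rewrite -ReB.
exact: le_lt_trans (normr_Re_le _) ye.
Qed.

Lemma continuous_Im : continuous (fun z : Cplx R => complex.Im z : R).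
Proof.
move=> z; apply: (proj2 (@cvgrPdist_lt _ R^o _ (nbhs z) _ _ _)) => e e0.
apply: filterS (near_cmod z e0) => y ye; rewrite -ImB.
exact: le_lt_trans (normr_Im_le _) ye.
Qed.

Lemma entire_continuous (v : R[i] -> R[i]) :
  entire v -> continuous (v : Cplx R -> Cplx R).
Proof.
move=> ev z; have := ev z; move/derivable1_diffP => /differentiable_continuous.
exact.
Qed.

Lemma continuous_horner_complex (A : {poly R[i]}) :
  continuous (fun z : Cplx R => A.[z] : Cplx R).
Proof.
elim/poly_ind: A => [|p c IH].
  have -> : (fun z : Cplx R => (0 : {poly R[i]}).[z] : Cplx R) = cst 0.
    by apply/funext => z; rewrite horner0.
  exact: cst_continuous.
have -> : (fun z : Cplx R => (p * 'X + c%:P).[z] : Cplx R) = (fun z => p.[z] * z + c).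
  by apply/funext => z; rewrite hornerMXaddC.
move=> z; apply: (@continuousD (Cplx R) (Cplx R) (Cplx R) (fun z => p.[z] * z) (cst c)).
  by apply: (@continuousM (Cplx R) (Cplx R) (fun z => p.[z]) id); [exact: IH|exact: cvg_id].
exact: cst_continuous.
Qed.

Lemma within_continuous_powR (a : R) : 0 < a ->
  {within `[0, +oo[, continuous (fun t : R => t `^ a)}.
Proof.
move=> a0; apply/continuous_within_itvcyP; split => [x|].
  by rewrite in_itv /= andbT => x0; exact: continuous_powR.
by rewrite powR0 ?gt_eqF //; exact: powR_cvg0.
Qed.

End ComplexContinuity.

(** * The Riemann-Liouville integral of a series *)

Section RealSeriesRL.
Variables (R : realType) (alpha : R).
Hypotheses (alpha_gt0 : 0 < alpha) (alpha_lt1 : alpha < 1).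
Notation mu := (@lebesgue_measure R).

Lemma weighted_series_Rintegral (w U : R -> R) (p : nat -> R) (K t : R) (N : nat) :
  0 <= t -> mu.-integrable `[0, t] (EFin \o w) ->
  (forall s, `[0, t]%classic s -> 0 <= w s) ->
  measurable_fun `[0, t] U ->
  (forall s, `[0, t]%classic s ->
     `|U s - \sum_(n < N) p n * (s `^ alpha) ^+ n| <= K) ->
  `|\int[mu]_(s in `[0, t]) (w s * U s) -
    \sum_(n < N) p n * \int[mu]_(s in `[0, t]) (w s * (s `^ alpha) ^+ n)| <=
  K * \int[mu]_(s in `[0, t]) w s.
Proof.
move=> t0 iw w0 mU UK.
pose S s := \sum_(n < N) p n * (s `^ alpha) ^+ n.
have mS : measurable_fun `[0, t] S.
  apply: measurable_sum => n; apply: measurable_funM => //.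
  by apply: measurable_funTS; apply: measurable_funX; exact: measurable_powR.
have iwn n : mu.-integrable `[0, t] (EFin \o (fun s => p n * (w s * (s `^ alpha) ^+ n))).
  by apply: integrableZl_EFin => //; exact: integrable_weight_monomial.
have [|iS eS] := Rintegral_sum N _ iwn; first exact: measurable_itv.
have E : (fun s => w s * S s) = (fun s => \sum_(n < N) p n * (w s * (s `^ alpha) ^+ n)).
  by apply/funext => s; rewrite mulr_sumr; apply: eq_bigr => n _; rewrite mulrCA.
have -> : \sum_(n < N) p n * \int[mu]_(s in `[0, t]) (w s * (s `^ alpha) ^+ n) =
    \int[mu]_(s in `[0, t]) (w s * S s).
  rewrite E eS; apply: eq_bigr => n _; rewrite RintegralZl //.
  exact: integrable_weight_monomial.
have iUS : mu.-integrable `[0, t] (EFin \o (fun s => w s * (U s - S s))).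
  by apply: (integrable_weight _ iw (M := K)) => //; exact: measurable_funB.
have iwS : mu.-integrable `[0, t] (EFin \o (fun s => w s * S s)) by rewrite E.
have -> : \int[mu]_(s in `[0, t]) (w s * U s) =
    \int[mu]_(s in `[0, t]) (w s * (U s - S s)) + \int[mu]_(s in `[0, t]) (w s * S s).
  rewrite -RintegralD //; apply: eq_Rintegral => s _; ring.
rewrite addrK; apply: (weighted_Rintegral_le _ iw) => //.
exact: measurable_funB.
Qed.

(** Both integrals are limits of those of the partial sums, which agree by
    [RL_monomial].  Partial sums with N + 1 terms are used since the recursion
    relates the first N coefficients of U to the first N + 1 ones of F. *)
Lemma RL_series (U F : R -> R) (p : nat -> R) (K t : R) :
  0 < t -> measurable_fun `[0, t] U -> measurable_fun `[0, t] F ->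
  (forall s N, `[0, t]%classic s ->
     `|U s - \sum_(n < N.+1) p n * (s `^ alpha) ^+ n| <= K / 2 ^+ N) ->
  (forall s N, `[0, t]%classic s ->
     `|F s - \sum_(n < N.+1) p n * RL_symbol alpha n * (s `^ alpha) ^+ n| <= K / 2 ^+ N) ->
  (Gamma (1 - alpha))^-1 * \int[mu]_(s in `[0, t]) ((t - s) `^ (- alpha) * U s) =
  \int[mu]_(s in `[0, t]) (s `^ (- alpha) * F s).
Proof.
move=> t0 mU mF UK FK; have G0 := Gamma_oma_gt0 alpha_gt0 alpha_lt1.
pose G := Gamma (1 - alpha); rewrite -/G in G0 *.
have i1 := integrable_powRN_sub alpha_lt1 (ltW t0).
have i2 := integrable_powRN alpha_lt1 (ltW t0).
set I := \int[mu]_(s in `[0, t]) _; set J := \int[mu]_(s in `[0, t]) _.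
pose a := \int[mu]_(s in `[0, t]) (t - s) `^ (- alpha).
pose b := \int[mu]_(s in `[0, t]) s `^ (- alpha).
suff H : `|G^-1 * I - J| <= 0 by apply/eqP; rewrite -subr_eq0 -normr_le0.
apply: (@le_dyadic_tail _ _ _ (K * (G^-1 * a + b))) => N; rewrite add0r.
have HU := weighted_series_Rintegral (ltW t0) i1
  (fun s _ => powR_ge0 _ _) mU (fun s => UK s N).
have HF := weighted_series_Rintegral
  (p := fun n => p n * RL_symbol alpha n) (ltW t0) i2
  (fun s _ => powR_ge0 _ _) mF (fun s => FK s N).
rewrite -/I -/J -/a -/b in HU HF.
set SU := \sum_(n < N.+1) _ in HU; set SF := \sum_(n < N.+1) _ in HF.
have SE : SU = G * SF.
  rewrite /SU /SF mulr_sumr; apply: eq_bigr => n _.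
  by rewrite RL_monomial // -/G; ring.
have -> : G^-1 * I - J = G^-1 * (I - SU) - (J - SF).
  by rewrite SE; field; rewrite gt_eqF.
apply: le_trans (ler_normB _ _) _.
rewrite normrM (gtr0_norm (_ : 0 < G^-1)) ?invr_gt0 //.
have HU' : G^-1 * `|I - SU| <= G^-1 * (K / 2 ^+ N * a).
  by apply: (ler_wpM2l _ HU); rewrite invr_ge0 ltW.
apply: le_trans (lerD HU' HF) _; rewrite le_eqVlt; apply/orP; left; apply/eqP.
by field; rewrite expf_neq0 // gt_eqF.
Qed.

End RealSeriesRL.

Section CauchyProduct.
Variable R : realType.

Lemma cauchy_product_partial (a c : nat -> R[i]) (x : R[i]) (m N : nat) :
  \sum_(n < N) x ^+ n * \sum_(j < m | (j <= n)%N) a j * c (n - j)%N =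
  \sum_(j < m) a j * x ^+ j * \sum_(k < N - j) c k * x ^+ k.
Proof.
elim: N => [|N IH].
  by rewrite big_ord0 big1 // => j _; rewrite sub0n big_ord0 mulr0.
rewrite big_ord_recr /= IH mulr_sumr [in X in _ + X]big_mkcond /= -big_split /=.
apply: eq_bigr => j _; case: leqP => jN.
  rewrite subSn // big_ord_recr /= mulrDr; congr (_ + _).
  by rewrite -{1}(subnKC jN) exprD; ring.
have [-> ->] : (N.+1 - j = 0)%N /\ (N - j = 0)%N by apply: conj; apply/eqP; rewrite subn_eq0 ?(ltnW jN).
  by rewrite addr0.
Qed.

End CauchyProduct.

(** * The power series solves the Cauchy problem *)

Section SeriesSolution.
Variables (R : realType) (alpha : R) (m : nat) (A : {poly R[i]}).
Hypotheses (alpha_gt0 : 0 < alpha) (alpha_lt1 : alpha < 1) (degA : size A = m.+1).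
Variables (c : nat -> R[i]) (E : R -> R) (v : R[i] -> R[i]).
Hypothesis cS : forall n, c n.+1 = ((RL_symbol alpha n.+1)^-1)%:C *
  \sum_(j < m.+1 | (j <= n)%N) A`_j * c (n - j)%N.
Hypothesis cE : forall (x : R) n, 0 <= x -> cmod (c n) * x ^+ n <= E x / 2 ^+ n.
Hypothesis E_homo : forall x y, 0 <= x -> x <= y -> E x <= E y.
Hypothesis vP : is_series_sum c E v.
Notation mu := (@lebesgue_measure R).
Local Notation G := (Gamma (1 - alpha)).

Let G_gt0 : 0 < G. Proof. exact: Gamma_oma_gt0. Qed.

(** The value at x = t^alpha of t^alpha times the Riemann-Liouville derivative
    of the solution, as prescribed by the equation. *)
Definition RL_image (x : R) : R[i] :=
  (G^-1)%:C * c 0%N + x%:C * A.[x%:C] * v x%:C.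

(** The recursion for the coefficients says exactly that the partial sums of
    the image are those of the constant term plus x A(x) v(x); the right-hand
    side is made of the tails of v. *)
Lemma RL_image_partial (x : R) N :
  RL_image x - \sum_(n < N.+1) c n * (RL_symbol alpha n)%:C * x%:C ^+ n =
  x%:C * \sum_(j < m.+1) A`_j * x%:C ^+ j *
    (v x%:C - \sum_(k < N - j) c k * x%:C ^+ k).
Proof.
have lam0 n : (RL_symbol alpha n.+1)%:C != 0 :> R[i].
  have [k k0 kP] := RL_symbol_ge alpha_gt0 alpha_lt1.
  rewrite -[X in _ != X](rmorph0 (real_complex R)) (inj_eq (@complexI R)) gt_eqF //.
  by apply: lt_le_trans (kP n); rewrite mulr_gt0 // powR_gt0.
rewrite big_ord_recl expr0 mulr1 RL_symbol0 //.
have -> : \sum_(i < N) c (lift ord0 i) * (RL_symbol alpha (lift ord0 i))%:C * x%:C ^+ lift ord0 i =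
    x%:C * \sum_(n < N) x%:C ^+ n * \sum_(j < m.+1 | (j <= n)%N) A`_j * c (n - j)%N.
  rewrite mulr_sumr; apply: eq_bigr => n _; rewrite !lift0 cS exprS.
  rewrite fmorphV; field; exact: lam0.
rewrite cauchy_product_partial /RL_image -/G horner_coef degA.
have -> : \sum_(j < m.+1) A`_j * x%:C ^+ j * (v x%:C - \sum_(k < N - j) c k * x%:C ^+ k) =
  (\sum_(j < m.+1) A`_j * x%:C ^+ j) * v x%:C -
  \sum_(j < m.+1) A`_j * x%:C ^+ j * \sum_(k < N - j) c k * x%:C ^+ k.
  by rewrite mulr_suml -sumrB; apply: eq_bigr => j _; rewrite mulrBr.
ring.
Qed.

Definition RL_image_bound (X : R) : R :=
  4 * E X + X * (\sum_(j < m.+1) cmod A`_j * X ^+ j) * (4 * E X * 2 ^+ m).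

Let cmodC (x : R) : 0 <= x -> cmod x%:C = x.
Proof. by move=> x0; rewrite cmod_real ger0_norm. Qed.

Let bound_ge0 X : 0 <= X -> 0 <= X * (\sum_(j < m.+1) cmod A`_j * X ^+ j).
Proof.
move=> X0; rewrite mulr_ge0 // sumr_ge0 // => j _.
by rewrite mulr_ge0 ?cmod_ge0 ?exprn_ge0.
Qed.

Lemma series_partial_le (x X : R) N : 0 <= x -> x <= X ->
  cmod (v x%:C - \sum_(n < N.+1) c n * x%:C ^+ n) <= RL_image_bound X / 2 ^+ N.
Proof.
move=> x0 xX; have X0 := le_trans x0 xX.
apply: le_trans (vP x%:C N.+1) _; rewrite cmodC //.
have EX : E x <= E X by exact: E_homo.
have E0 : 0 <= E x := series_bound_ge0 cE x0.
apply: le_trans (_ : 4 * E X / 2 ^+ N <= _).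
  rewrite exprS invfM mulrA ler_wpM2r ?invr_ge0 ?exprn_ge0 //.
  lra.
rewrite ler_wpM2r ?invr_ge0 ?exprn_ge0 // /RL_image_bound lerDl.
by rewrite mulr_ge0 ?bound_ge0 // !mulr_ge0 ?exprn_ge0 // (le_trans E0).
Qed.

Lemma RL_image_partial_le (x X : R) N : 0 <= x -> x <= X ->
  cmod (RL_image x - \sum_(n < N.+1) c n * (RL_symbol alpha n)%:C * x%:C ^+ n) <=
  RL_image_bound X / 2 ^+ N.
Proof.
move=> x0 xX; have X0 := le_trans x0 xX.
have EX : E x <= E X by exact: E_homo.
have E0 : 0 <= E x := series_bound_ge0 cE x0.
rewrite RL_image_partial cmodM cmodC //.
apply: le_trans (_ : X * (\sum_(j < m.+1) cmod A`_j * X ^+ j) *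
    (4 * E X * 2 ^+ m) / 2 ^+ N <= _); last first.
  rewrite ler_wpM2r ?invr_ge0 ?exprn_ge0 // /RL_image_bound lerDr mulr_ge0 //.
  exact: le_trans EX.
rewrite -!mulrA; apply: ler_pM; rewrite ?cmod_ge0 //.
rewrite mulr_suml; apply: le_trans (cmod_sum _ _ _) _; apply: ler_sum => j _.
rewrite !cmodM cmodX cmodC //.
apply: ler_pM; rewrite ?mulr_ge0 ?cmod_ge0 ?exprn_ge0 //.
  by rewrite ler_wpM2l ?cmod_ge0 // lerXn2r ?nnegrE.
apply: le_trans (vP x%:C (N - j)%N) _; rewrite cmodC //.
rewrite -!mulrA; apply: ler_pM; rewrite ?mulr_ge0 ?invr_ge0 ?exprn_ge0 //.
apply: ler_pM; rewrite ?mulr_ge0 ?invr_ge0 ?exprn_ge0 //.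
rewrite ler_pdivlMr ?exprn_gt0 // mulrC ler_pdivrMr ?exprn_gt0 // -exprD.
apply: ler_weXn2l; first lra.
by rewrite -leq_subLR leq_sub2l // -ltnS.
Qed.

Let u (t : R) : R[i] := v (t `^ alpha)%:C.

Let entire_v : entire v. Proof. exact: (series_sum_entire cE vP). Qed.

Let continuous_v : continuous (fun x : R => v x%:C : Cplx R).
Proof.
move=> x; apply: (continuous_comp (@continuous_real_complex R x)).
exact: (entire_continuous entire_v).
Qed.

Lemma continuous_RL_image : continuous (RL_image : R -> Cplx R).
Proof.
move=> x.
apply: (@continuousD (Cplx R) (Cplx R) R (cst ((G^-1)%:C * c 0%N))
  (fun x => x%:C * A.[x%:C] * v x%:C)); first exact: cst_continuous.
apply: (@continuousM (Cplx R) R (fun x => x%:C * A.[x%:C]) (fun x => v x%:C));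
  last exact: continuous_v.
apply: (@continuousM (Cplx R) R (fun x => x%:C) (fun x => A.[x%:C])).
  exact: continuous_real_complex.
apply: (continuous_comp (@continuous_real_complex R x)).
exact: continuous_horner_complex.
Qed.

Let measurable_comp_powR (f : R -> R) : continuous f ->
  measurable_fun setT (fun s : R => f (s `^ alpha)).
Proof.
move=> cf.
apply: measurableT_comp (measurable_powR alpha).
exact: continuous_measurable_fun.
Qed.

Let cRe (f : R -> Cplx R) : continuous f -> continuous (fun x => complex.Re (f x)).
Proof. by move=> cf x; apply: (continuous_comp (cf x)); exact: continuous_Re. Qed.

Let cIm (f : R -> Cplx R) : continuous f -> continuous (fun x => complex.Im (f x)).
Proof. by move=> cf x; apply: (continuous_comp (cf x)); exact: continuous_Im. Qed.

Definition RL_density_Re (s : R) := s `^ (- alpha) * complex.Re (RL_image (s `^ alpha)).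
Definition RL_density_Im (s : R) := s `^ (- alpha) * complex.Im (RL_image (s `^ alpha)).

Let powR_le_end (s t : R) : `[0, t]%classic s -> 0 <= s `^ alpha <= t `^ alpha.
Proof.
rewrite /= in_itv /= powR_ge0 /= => /andP[s0 st].
by apply: ge0_ler_powR; rewrite ?nnegrE ?(le_trans s0 st) // ltW.
Qed.

Lemma integrable_RL_density (T : R) : 0 <= T ->
  mu.-integrable `[0, T] (EFin \o RL_density_Re) /\
  mu.-integrable `[0, T] (EFin \o RL_density_Im).
Proof.
move=> T0; pose K := RL_image_bound (T `^ alpha) + cmod (c 0%N * (RL_symbol alpha 0)%:C).
have bd s : `[0, T]%classic s -> cmod (RL_image (s `^ alpha)) <= K.
  move=> /powR_le_end /andP[s0 sT].
  have := RL_image_partial_le 0 s0 sT.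
  rewrite big_ord_recl big_ord0 addr0 [_%:C ^+ _]expr0 mulr1 expr0 divr1 /= => H.
  rewrite -[RL_image _](subrK (c 0%N * (RL_symbol alpha 0)%:C)).
  by apply: le_trans (cmodD _ _) _; rewrite lerD2r.
have iw := integrable_powRN alpha_lt1 T0.
split; apply: (integrable_weight _ iw (M := K)) => //.
- exact: measurable_funTS (measurable_comp_powR (cRe continuous_RL_image)).
- by move=> s sT; apply: le_trans (normr_Re_le _) (bd s sT).
- exact: measurable_funTS (measurable_comp_powR (cIm continuous_RL_image)).
- by move=> s sT; apply: le_trans (normr_Im_le _) (bd s sT).
Qed.

(** Real and imaginary parts are treated separately, as the coefficients of
    the real series are the real and imaginary parts of c. *)
Lemma RLint_series (t : R) : RLint alpha u t =
  (\int[mu]_(s in `[0, t]) RL_density_Re s) +i*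
  (\int[mu]_(s in `[0, t]) RL_density_Im s).
Proof.
rewrite /RLint /Cintegral -/G.
have [t0|t0|<-] := ltgtP t 0; last 1 first.
- by rewrite set_itv1 !Rintegral_set1; apply: complex_eq; rewrite ?ReZ ?ImZ mulr0.
- have -> : `[0, t]%classic = set0 :> set R by rewrite set_itv_ge // bnd_simp -ltNge.
  by rewrite !Rintegral_set0; apply: complex_eq; rewrite ?ReZ ?ImZ mulr0.
have mon n (x : R) : c n * x%:C ^+ n = (x ^+ n)%:C * c n by rewrite mulrC rmorphXn.
have mon' n (x : R) : c n * (RL_symbol alpha n)%:C * x%:C ^+ n =
    (RL_symbol alpha n * x ^+ n)%:C * c n.
  by rewrite (rmorphM (real_complex R) (RL_symbol alpha n)) rmorphXn; ring.
apply: complex_eq; rewrite ?ReZ ?ImZ /=.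
- under [X in _ * X]eq_Rintegral do rewrite ReZ.
  apply: (RL_series alpha_gt0 alpha_lt1 (p := fun n => complex.Re (c n))
    (K := RL_image_bound (t `^ alpha)) t0).
  + exact: measurable_funTS (measurable_comp_powR (cRe continuous_v)).
  + exact: measurable_funTS (measurable_comp_powR (cRe continuous_RL_image)).
  + move=> s N /powR_le_end /andP[s0 st].
    apply: le_trans (series_partial_le N s0 st); apply: le_trans (normr_Re_le _).
    rewrite ReB Re_sum le_eqVlt; apply/orP; left; apply/eqP; congr (`| _ - _ |).
    by apply: eq_bigr => n _; rewrite mon ReZ mulrC.
  + move=> s N /powR_le_end /andP[s0 st].
    apply: le_trans (RL_image_partial_le N s0 st); apply: le_trans (normr_Re_le _).
    rewrite ReB Re_sum le_eqVlt; apply/orP; left; apply/eqP; congr (`| _ - _ |).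
    by apply: eq_bigr => n _; rewrite mon' ReZ; ring.
- under [X in _ * X]eq_Rintegral do rewrite ImZ.
  apply: (RL_series alpha_gt0 alpha_lt1 (p := fun n => complex.Im (c n))
    (K := RL_image_bound (t `^ alpha)) t0).
  + exact: measurable_funTS (measurable_comp_powR (cIm continuous_v)).
  + exact: measurable_funTS (measurable_comp_powR (cIm continuous_RL_image)).
  + move=> s N /powR_le_end /andP[s0 st].
    apply: le_trans (series_partial_le N s0 st); apply: le_trans (normr_Im_le _).
    rewrite ImB Im_sum le_eqVlt; apply/orP; left; apply/eqP; congr (`| _ - _ |).
    by apply: eq_bigr => n _; rewrite mon ImZ mulrC.
  + move=> s N /powR_le_end /andP[s0 st].
    apply: le_trans (RL_image_partial_le N s0 st); apply: le_trans (normr_Im_le _).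
    rewrite ImB Im_sum le_eqVlt; apply/orP; left; apply/eqP; congr (`| _ - _ |).
    by apply: eq_bigr => n _; rewrite mon' ImZ; ring.
Qed.

(** The density of the Riemann-Liouville integral at t > 0 is
    t^(-alpha) c_0 / Gamma(1 - alpha) + A(t^alpha) u(t), and the correction in
    the Caputo derivative removes the first term. *)
Lemma series_solution : Cauchy_solution alpha A (c 0%N) u.
Proof.
have v0 : v 0 = c 0%N := series_sum0 vP.
have u0 : u 0 = c 0%N by rewrite /u powR0 ?gt_eqF.
split; [| | |exact: u0].
- apply: (@within_continuous_comp _ _ _ _ (fun t : R => t `^ alpha)
    (fun x : R => v x%:C : Cplx R)); last exact: within_continuous_powR.
  by move=> x _; exact: continuous_v.
- move=> T T0; have [i1 i2] := integrable_RL_density (ltW T0).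
  exact: (abs_continuous_indefinite i1 i2 RLint_series).
- move=> t t0; have t1 : t < t + 1 by rewrite ltrDl.
  have [i1 i2] := integrable_RL_density (ltW (lt_trans t0 t1)).
  have cpow (f : R -> R) : continuous f ->
      {for t, continuous (fun s : R => s `^ (- alpha) * f (s `^ alpha))}.
    move=> cf; apply: continuousM; first exact: continuous_powR.
    by apply: continuous_comp; [exact: continuous_powR|exact: cf].
  have [d1 e1] := continuous_FTC1_closed t1 i1 t0 (cpow _ (cRe continuous_RL_image)).
  have [d2 e2] := continuous_FTC1_closed t1 i2 t0 (cpow _ (cIm continuous_RL_image)).
  have ERe : (fun x => complex.Re (RLint alpha u x)) =
     (fun x => \int[mu]_(s in `[0, x]) RL_density_Re s).
    by apply/funext => x; rewrite RLint_series.
  have EIm : (fun x => complex.Im (RLint alpha u x)) =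
     (fun x => \int[mu]_(s in `[0, x]) RL_density_Im s).
    by apply/funext => x; rewrite RLint_series.
  split.
    by split; [rewrite ERe; exact: d1|rewrite EIm; exact: d2].
  rewrite /Caputo /RLderive /Cderive ERe EIm e1 e2 u0.
  have -> : RL_density_Re t +i* RL_density_Im t =
      (t `^ (- alpha))%:C * RL_image (t `^ alpha).
    by apply: complex_eq; rewrite ?ReZ ?ImZ.
  have ta0 : t `^ alpha != 0 by rewrite gt_eqF // powR_gt0.
  have taC0 : (t `^ alpha)%:C != 0 :> R[i].
    by rewrite -[X in _ != X](rmorph0 (real_complex R)) (inj_eq (@complexI R)).
  have GC0 : G%:C != 0 :> R[i].
    by rewrite -[X in _ != X](rmorph0 (real_complex R)) (inj_eq (@complexI R)) gt_eqF.
  rewrite /RL_image powRN -/(u t) -/G !fmorphV rmorphM /=.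
  by field; rewrite taC0 GC0.
Qed.

End SeriesSolution.

(** * Composition of Abel convolutions *)

Section AbelComposition.
Variable R : realType.
Notation mu := (@lebesgue_measure R).
Notation X := (measurableTypeR R).
Variables (a b t : R) (g : R -> R).
Hypotheses (a0 : 0 < a) (b0 : 0 < b) (mg : measurable_fun setT g).

(* Leaving out the diagonal makes the section at s = t empty. *)
Let domain (z : X * X) : bool := (0 <= z.2) && ((z.2 < z.1) && (z.1 <= t)).

Let kernel (z : X * X) : R :=
  if domain z then (t - z.1) `^ (a - 1) * ((z.1 - z.2) `^ (b - 1) * g z.2) else 0.

Let measurable_kernel : measurable_fun setT kernel.
Proof.
have m1 : measurable_fun [set: X * X] (fun z : X * X => z.1 : R) by exact: measurable_fst.
have m2 : measurable_fun [set: X * X] (fun z : X * X => z.2 : R) by exact: measurable_snd.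
apply: measurable_fun_ifT => //.
- apply: measurable_and; first exact: measurable_fun_ler.
  by apply: measurable_and; [exact: measurable_fun_ltr|exact: measurable_fun_ler].
- apply: measurable_funM.
    by apply: measurable_powR_comp; exact: measurable_funB.
  apply: measurable_funM; last exact: measurableT_comp mg m2.
  by apply: measurable_powR_comp; exact: measurable_funB.
Qed.

Hypothesis g0 : forall s, 0 <= s <= t -> 0 <= g s.

Let kernel_ge0 z : (0 <= (kernel z)%:E)%E.
Proof.
rewrite lee_fin /kernel; case: ifP => // /and3P[h1 h2 h3].
by rewrite !mulr_ge0 ?powR_ge0 // g0 // h1 (le_trans (ltW h2) h3).
Qed.

Let measurable_kernelE : measurable_fun setT (EFin \o kernel).
Proof. by apply/measurable_EFinP; exact: measurable_kernel. Qed.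

Let mw x e : measurable_fun [set: X] (fun s : R => ((x - s) `^ e * g s)%:E).
Proof.
have mgs : measurable_fun [set: X] g by exact: mg.
apply/measurable_EFinP; apply: measurable_funM => //.
by apply: measurable_powR_comp; exact: measurable_funB.
Qed.

Let kernel_section (x : R) : 0 <= x <= t ->
  (\int[mu]_s (kernel (x, s))%:E = ((t - x) `^ (a - 1))%:E *
     \int[mu]_(s in `[0%R, x]) ((x - s) `^ (b - 1) * g s)%:E)%E.
Proof.
move=> /andP[x0 xt].
rewrite -ge0_integralZl_EFin; [|exact: measurable_itv|
  |exact: measurable_funTS (mw x (b - 1))|exact: powR_ge0]; last first.
  move=> s /=; rewrite in_itv /= => /andP[s0 sx]; rewrite lee_fin.
  by rewrite mulr_ge0 ?powR_ge0 // g0 // s0 (le_trans sx xt).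
rewrite -integral_itv_bndo_bndc; last first.
  by apply: measurable_funTS; apply: measurable_funeM; exact: mw.
rewrite [RHS]integral_mkcond; apply: eq_integral => s _.
rewrite patchE /kernel /domain /= xt andbT.
case: ifPn => [sx|sN]; first by rewrite mem_set //= in_itv.
by rewrite memNset //= in_itv /=; apply/negP.
Qed.

Lemma measurable_Abel : measurable_fun `[0%R, t]
  (fun x : X => ((t - x) `^ (a - 1))%:E *
     \int[mu]_(s in `[0%R, x]) ((x - s) `^ (b - 1) * g s)%:E)%E.
Proof.
apply: (eq_measurable_fun (fubini_F mu (EFin \o kernel))).
  by move=> x; rewrite inE /= in_itv /= => xt; rewrite -kernel_section.
apply: measurable_funTS.
exact: (measurable_fun_fubini_tonelli_F (EFin \o kernel) measurable_kernelE kernel_ge0).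
Qed.

(** Exchange the order of integration over the triangle 0 <= s < x <= t; the
    inner integral over x is a Beta integral over [s, t]. *)
Lemma Tonelli_Abel : (\int[mu]_(x in `[0%R, t]) (((t - x) `^ (a - 1))%:E *
     \int[mu]_(s in `[0%R, x]) ((x - s) `^ (b - 1) * g s)%:E) =
   \int[mu]_(s in `[0%R, t]) ((Beta a b)%:E * ((t - s) `^ (a + b - 1) * g s)%:E))%E.
Proof.
have := @fubini_tonelli _ _ X X R mu mu (EFin \o kernel)
  measurable_kernelE kernel_ge0.
have -> : (\int[mu]_x \int[mu]_y (EFin \o kernel) (x, y) =
    \int[mu]_(x in `[0%R, t]) (((t - x) `^ (a - 1))%:E *
     \int[mu]_(s in `[0%R, x]) ((x - s) `^ (b - 1) * g s)%:E))%E.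
  rewrite [RHS]integral_mkcond; apply: eq_integral => x _.
  rewrite patchE; case: ifPn => [|xN].
    rewrite inE /= in_itv /= => /andP[x0 xt].
    by apply: kernel_section; rewrite x0.
  apply: integral0_eq => s _ /=; rewrite /kernel; case: ifP => // /and3P[/= h1 h2 h3].
  by move: xN; rewrite notin_setE /= in_itv /= h3 (le_trans h1 (ltW h2)).
have -> : (\int[mu]_y \int[mu]_x (EFin \o kernel) (x, y) =
    \int[mu]_(s in `[0%R, t[) ((Beta a b)%:E * ((t - s) `^ (a + b - 1) * g s)%:E))%E.
  rewrite [RHS]integral_mkcond; apply: eq_integral => s _.
  rewrite patchE; case: ifPn => [|sN].
    rewrite inE /= in_itv /= => /andP[s0 st].
    have gs0 : 0 <= g s by rewrite g0 // s0 ltW.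
    transitivity (\int[mu]_(x in `]s, t]) ((g s)%:E *
        ((t - x) `^ (a - 1) * (x - s) `^ (b - 1))%:E))%E.
      rewrite [RHS]integral_mkcond; apply: eq_integral => x _.
      rewrite patchE /kernel /domain /= s0 /=.
      case: ifPn => [sx|sN].
        by rewrite mem_set /= ?in_itv // -EFinM; congr EFin; ring.
      by rewrite memNset //= in_itv /=; apply/negP.
    have mq : measurable_fun [set: X]
        (fun x : R => ((t - x) `^ (a - 1) * (x - s) `^ (b - 1))%:E).
      apply/measurable_EFinP; apply: measurable_funM;
      by apply: measurable_powR_comp; exact: measurable_funB.
    rewrite ge0_integralZl_EFin; [|exact: measurable_itv
      |by move=> x _; rewrite lee_fin mulr_ge0 ?powR_ge0
      |exact: measurable_funTS mq|exact: gs0].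
    rewrite integral_itv_obnd_cbnd; last exact: measurable_funTS mq.
    rewrite integral_beta_scale // -EFin_Beta // -!EFinM; congr EFin; ring.
  apply: integral0_eq => x _ /=; rewrite /kernel.
  case: ifP => // /and3P[/= s0 sx xt].
  by move: sN; rewrite notin_setE /= in_itv /= s0 (lt_le_trans sx xt).
move=> ->; apply: integral_itv_bndo_bndc.
by apply: measurable_funTS; apply: measurable_funeM; exact: mw.
Qed.

End AbelComposition.

Section AbelBounded.
Variable R : realType.
Notation mu := (@lebesgue_measure R).

(** The fractional integral of order b without its factor 1 / Gamma(b), which
    makes the Beta integral the only constant in the composition law. *)
Definition RL_conv (b : R) (g : R -> R) (x : R) : R :=
  \int[mu]_(s in `[0, x]) ((x - s) `^ (b - 1) * g s).

Lemma integrable_RL_conv (b M x : R) (g : R -> R) : 0 < b -> 0 <= x ->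
  measurable_fun setT g -> (forall s, 0 <= s <= x -> `|g s| <= M) ->
  mu.-integrable `[0, x] (EFin \o (fun s => (x - s) `^ (b - 1) * g s)).
Proof.
move=> b0 x0 mg gM.
apply: (integrable_weight _ (integrable_powR_sub b0 x0) (M := M)) => //.
exact: measurable_funTS mg.
Qed.

Lemma Abel_nonneg (a b t M : R) (g : R -> R) : 0 < a -> 0 < b -> 0 < a + b ->
  0 <= t -> measurable_fun setT g -> (forall s, 0 <= s <= t -> 0 <= g s <= M) ->
  mu.-integrable `[0, t] (EFin \o (fun x => (t - x) `^ (a - 1) * RL_conv b g x)) /\
  RL_conv a (RL_conv b g) t = Beta a b * RL_conv (a + b) g t.
Proof.
move=> a0 b0 ab0 t0 mg gM.
have g0 s : 0 <= s <= t -> 0 <= g s by move=> /gM /andP[].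
have gM' x s : x <= t -> 0 <= s <= x -> `|g s| <= M.
  move=> xt /andP[s0 sx]; have st : 0 <= s <= t by rewrite s0 (le_trans sx xt).
  by have /andP[? ?] := gM s st; rewrite ger0_norm.
have inner x : `[0%R, t]%classic x -> ((t - x) `^ (a - 1) * RL_conv b g x)%:E =
    (((t - x) `^ (a - 1))%:E *
     \int[mu]_(s in `[0%R, x]) ((x - s) `^ (b - 1) * g s)%:E)%E.
  rewrite /= in_itv /= => /andP[x0 xt]; rewrite EFinM /RL_conv /Rintegral fineK //.
  apply: integrable_fin_num => //.
  exact: (integrable_RL_conv b0 x0 mg (fun s => @gM' x s xt)).
have iab := integrable_RL_conv ab0 t0 mg (fun s => @gM' t s (lexx t)).
have outer : (\int[mu]_(x in `[0%R, t]) ((t - x) `^ (a - 1) * RL_conv b g x)%:E =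
    (Beta a b * RL_conv (a + b) g t)%:E)%E.
  transitivity (\int[mu]_(x in `[0%R, t]) (((t - x) `^ (a - 1))%:E *
     \int[mu]_(s in `[0%R, x]) ((x - s) `^ (b - 1) * g s)%:E))%E.
    by apply: eq_integral => x; rewrite inE => /inner.
  have -> : (Beta a b * RL_conv (a + b) g t)%:E = ((Beta a b)%:E *
     \int[mu]_(s in `[0%R, t]) ((t - s) `^ (a + b - 1) * g s)%:E)%E.
    rewrite EFinM; congr (_ * _)%E; rewrite /RL_conv /Rintegral fineK //.
    by apply: integrable_fin_num => //; exact: iab.
  by rewrite Tonelli_Abel // integralZl.
split; last by rewrite [LHS]/RL_conv /Rintegral outer.
apply/integrableP; split.
  have E : {in `[0%R, t]%classic, (fun x : R => ((t - x) `^ (a - 1))%:E *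
      \int[mu]_(s in `[0%R, x]) ((x - s) `^ (b - 1) * g s)%:E)%E =1
      EFin \o (fun x => (t - x) `^ (a - 1) * RL_conv b g x)}.
    by move=> x; rewrite inE => xt; exact/esym/inner.
  by apply: (eq_measurable_fun _ E); exact: measurable_Abel.
rewrite (_ : (\int[mu]_(x in _) _)%E = (Beta a b * RL_conv (a + b) g t)%:E) ?ltry //.
rewrite -outer; apply: eq_integral => x; rewrite inE /= in_itv /= => /andP[x0 xt].
suff nn : 0 <= RL_conv b g x by congr EFin; apply: ger0_norm; rewrite mulr_ge0 ?powR_ge0.
apply: Rintegral_ge0 => s; rewrite /= in_itv /= => /andP[s0 sx].
by rewrite mulr_ge0 ?powR_ge0 // g0 // s0 (le_trans sx xt).
Qed.

(** The semigroup law of fractional integration, up to the normalizing Beta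
    factor.  Tonelli's theorem covers nonnegative functions; a bounded g is the
    difference of g + M and M. *)
Lemma RL_conv_comp (a b t M : R) (g : R -> R) : 0 < a -> 0 < b ->
  0 <= t -> measurable_fun setT g -> (forall s, 0 <= s <= t -> `|g s| <= M) ->
  RL_conv a (RL_conv b g) t = Beta a b * RL_conv (a + b) g t.
Proof.
move=> a0 b0 t0 mg gM.
have ab0 : 0 < a + b by rewrite addr_gt0.
have M0 : 0 <= M.
  by apply: le_trans (gM 0 _); rewrite ?lexx.
have gM2 s : 0 <= s <= t -> 0 <= g s + M <= M + M.
  by move=> /gM; rewrite ler_norml => /andP[? ?]; apply/andP; lra.
have cM s : 0 <= s <= t -> 0 <= cst M s <= M by rewrite /= M0 lexx.
have [i1 e1] := Abel_nonneg a0 b0 ab0 t0 (measurable_funD mg (measurable_cst _)) gM2.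
have [i2 e2] := Abel_nonneg a0 b0 ab0 t0 (measurable_cst _) cM.
have add (c x : R) : 0 < c -> 0 <= x <= t ->
    RL_conv c (fun s => g s + M) x = RL_conv c g x + RL_conv c (cst M) x.
  move=> c0 /andP[x0 xt]; rewrite /RL_conv -RintegralD //.
  - by apply: eq_Rintegral => s _; rewrite mulrDr.
  - apply: (integrable_RL_conv (M := M)) => // s /andP[s0 sx].
    by apply: gM; rewrite s0 (le_trans sx xt).
  - by apply: (integrable_RL_conv (M := M)) => // s _; rewrite /= ger0_norm.
have E : RL_conv a (RL_conv b g) t =
    RL_conv a (RL_conv b (fun s => g s + M)) t - RL_conv a (RL_conv b (cst M)) t.
  rewrite /RL_conv -RintegralB //; apply: eq_Rintegral => x; rewrite inE /= in_itv /= => xt.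
  by rewrite -[X in _ = _ * X - _]/(RL_conv b (fun s => g s + M) x) add // mulrDr addrK.
rewrite E e1 e2 add // ?t0 ?lexx //; ring.
Qed.

End AbelBounded.

(** * A local bound for Abel integral equations *)

Section LocalBound.
Variable R : realType.
Notation mu := (@lebesgue_measure R).

Lemma eq_Rintegral_support (A B : set R) (f : R -> R) :
  (forall x, A x -> ~ B x -> f x = 0) -> (forall x, B x -> ~ A x -> f x = 0) ->
  \int[mu]_(x in A) f x = \int[mu]_(x in B) f x.
Proof.
move=> AB BA; rewrite Rintegral_mkcond [RHS]Rintegral_mkcond.
apply: eq_Rintegral => x _; rewrite !patchE.
case: ifPn => [/set_mem xA|xA]; case: ifPn => [/set_mem xB|xB] //.
  by apply: AB => // /mem_set; apply/negP.
by apply/esym; apply: BA => // /mem_set; apply/negP.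
Qed.

Lemma Rintegral_reflect (t : R) (g : R -> R) : measurable_fun setT g ->
  \int[mu]_(s in `[0, t]) g s = \int[mu]_(s in `[0, t]) g (t - s).
Proof.
move=> mg.
have mgE : measurable_fun setT (EFin \o g) by apply/measurable_EFinP.
have D : [set x | `[0%R, t]%classic (-1 * x + t)] = `[0, t]%classic.
  apply/seteqP; split => x /=; rewrite !in_itv /= => /andP[? ?]; apply/andP; lra.
have refl (f : R -> \bar R) : measurable_fun setT f -> (forall x, (0 <= f x)%E) ->
    (\int[mu]_(s in `[0%R, t]) f s = \int[mu]_(s in `[0%R, t]) f (t - s)%R)%E.
  move=> mf f0.
  rewrite (@ge0_integral_affine R (-1) t `[0%R, t]%classic) ?oppr_eq0 ?oner_eq0 //;
    last exact: measurable_funTS.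
  rewrite normrN1 mul1e D.
  by apply: eq_integral => x _; rewrite mulN1r addrC.
rewrite /Rintegral integralE [in RHS]integralE; congr (fine (_ - _)%E).
  rewrite (refl (EFin \o g)^\+%E); [|exact: measurable_funepos|by []].
  by apply: eq_integral => x _; rewrite !funeposE.
rewrite (refl (EFin \o g)^\-%E); [|exact: measurable_funeneg|by []].
by apply: eq_integral => x _; rewrite !funenegE.
Qed.

Lemma lipschitz_continuous_real (G : R -> R) (M : R) :
  (forall x y, x <= y -> `|G y - G x| <= M * (y - x)) -> continuous G.
Proof.
move=> GL x; apply/cvgrPdist_lt => e e0.
have GL' y : `|G x - G y| <= M * `|x - y|.
  have [xy|yx] := leP x y.
    by rewrite distrC (distrC x) [`|y - x|]ger0_norm ?subr_ge0 // GL.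
  by rewrite [`|x - y|]gtr0_norm ?subr_gt0 // GL // ltW.
have M0 : 0 <= M.
  by have := le_trans (normr_ge0 _) (GL 0 1 ler01); rewrite subr0 mulr1.
near=> y.
apply: le_lt_trans (GL' y) _.
apply: le_lt_trans (_ : (M + 1) * `|x - y| < _); first by rewrite ler_wpM2r //; lra.
rewrite mulrC -ltr_pdivlMr; last lra.
near: y; apply: (@cvgr_dist_lt _ R^o) => //; rewrite divr_gt0 //; lra.
Unshelve. all: by end_near. Qed.

(** By continuity at t, a value larger than C would be seen by the average
    over a short interval ]t, t + d]. *)
Lemma norm_le_of_average (h : R -> R) (t t1 C : R) : continuous h -> t < t1 ->
  (forall d, 0 < d -> t + d <= t1 -> `|\int[mu]_(s in `]t, (t + d)]) h s| <= C * d) ->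
  `|h t| <= C.
Proof.
move=> ch tt1 hC; apply/ler_addgt0Pr => e e0.
have /cvgrPdist_lt /(_ e e0) /nbhs_ballP[r /= r0 hr] := ch t.
pose d := Num.min (r / 2) (t1 - t).
have d0 : 0 < d by rewrite lt_min divr_gt0 //= subr_gt0.
have dr : d < r.
  by apply: le_lt_trans (_ : r / 2 < r); [rewrite ge_min lexx|lra].
have dt : t + d <= t1 by rewrite -lerBrDl ge_min lexx orbT.
have mD : measurable `]t, (t + d)]%classic by exact: measurable_itv.
have muD : mu `]t, (t + d)]%classic = d%:E.
  rewrite lebesgue_measure_itv /= lte_fin ltrDl d0 -EFinD; congr EFin; ring.
have icstI (k : R) : mu.-integrable `]t, (t + d)] (EFin \o cst k).
  apply/integrableP; split; first by apply/measurable_EFinP; exact: measurable_cst.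
  by rewrite (eq_integral (cst `|k|%:E)) // integral_cst // [X in (_ * X)%E]muD ltry.
have i1 := icstI 1.
have icst (k : R) : \int[mu]_(s in `]t, (t + d)]) k = k * d.
  by rewrite Rintegral_cst // [X in fine X]muD.
have mh : measurable_fun setT h by exact: continuous_measurable_fun.
have bd s : `]t, (t + d)]%classic s -> `|h s - h t| <= e.
  rewrite /= in_itv /= => /andP[ts std]; rewrite distrC ltW //; apply: hr.
  rewrite -ball_normE /= distrC gtr0_norm ?subr_gt0 //.
  by apply: le_lt_trans dr; rewrite lerBlDl.
have ihd : mu.-integrable `]t, (t + d)] (EFin \o (fun s => cst 1 s * (h s - h t))).
  apply: (integrable_weight _ i1 (f := fun s => h s - h t) (M := e)) => //.
  by apply: measurable_funB => //; exact: measurable_funTS.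
have H1 : `|\int[mu]_(s in `]t, (t + d)]) (cst 1 s * (h s - h t))| <= e * d.
  rewrite -[d in leRHS]mul1r -icst; apply: (weighted_Rintegral_le _ i1 (f := fun s => h s - h t)) => //.
  by apply: measurable_funB => //; exact: measurable_funTS.
have icst' : mu.-integrable `]t, (t + d)] (EFin \o cst (h t)).
  exact: icstI.
have E : \int[mu]_(s in `]t, (t + d)]) h s =
    \int[mu]_(s in `]t, (t + d)]) (cst 1 s * (h s - h t)) + h t * d.
  rewrite -icst -RintegralD //; apply: eq_Rintegral => s _ /=; ring.
have := hC d d0 dt; rewrite E => H2.
rewrite -(ler_pM2r d0) mulrDl.
have -> : `|h t| * d = `|h t * d| by rewrite normrM (gtr0_norm d0).
set I := \int[mu]_(s in _) _ in H1 H2.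
have -> : h t * d = (I + h t * d) - I by ring.
exact: le_trans (ler_normB _ _) (lerD H2 H1).
Qed.

End LocalBound.

Section AbelLocalBound.
Variable R : realType.
Notation mu := (@lebesgue_measure R).

Lemma continuous_bounded_itv (h : R -> R) (T : R) : continuous h -> 0 <= T ->
  exists M, forall s, 0 <= s <= T -> `|h s| <= M.
Proof.
move=> ch T0.
have cn : {within `[0, T], continuous (fun s => `|h s|)}.
  apply: continuous_subspaceT => s.
  by apply: (continuous_comp (ch s)); exact: norm_continuous.
have [c _ cP] := EVT_max T0 cn.
by exists `|h c| => s s01; apply: cP; rewrite in_itv.
Qed.

Lemma continuous_integrable_itv (h : R -> R) (a b : R) : continuous h ->
  mu.-integrable `[a, b] (EFin \o h).
Proof.
move=> ch; apply: continuous_compact_integrable; first exact: segment_compact.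
exact: continuous_subspaceT.
Qed.

(** Applying J^alpha to the equation gives the integral of h over [0, x] as
    k / B(alpha, 1-alpha) times J^alpha G (x), where G is the integral of f.
    As G vanishes before t0, J^alpha G (x) can be written as K x, the integral
    over the fixed interval [0, t1 - t0] of s^(alpha-1) G(x - s).  The
    Lipschitz constant M of G thus passes to K with the factor
    (t1 - t0)^alpha / alpha, and averages of h are increments of K. *)
Lemma Abel_local_bound (alpha k T t0 t1 M t : R) (h f : R -> R) :
  0 < alpha -> alpha < 1 -> 0 < k -> continuous h -> continuous f ->
  (forall x, 0 <= x <= T -> RL_conv (1 - alpha) h x = k * \int[mu]_(s in `[0, x]) f s) ->
  0 <= t0 -> t1 <= T ->
  (forall s, 0 <= s < t0 -> f s = 0) -> (forall s, 0 <= s < t1 -> `|f s| <= M) ->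
  t0 <= t < t1 ->
  `|h t| <= k / Beta alpha (1 - alpha) * (M * ((t1 - t0) `^ alpha / alpha)).
Proof.
move=> al0 al1 k0 ch cf hJ t00 t1T fz fM /andP[t0t tt1].
have t10 : 0 < t1 by apply: le_lt_trans tt1; apply: le_trans t0t.
have oma0 : 0 < 1 - alpha by rewrite subr_gt0.
have M0 : 0 <= M by apply: le_trans (fM 0 _); rewrite ?lexx.
have intf a b : mu.-integrable `[a, b] (EFin \o f) by exact: continuous_integrable_itv.
pose G0 x := \int[mu]_(s in `[0, x]) f s.
(* Truncation at t1 makes the Lipschitz bound global. *)
pose G x := G0 (Num.min x t1).
have G0N x : x < 0 -> G0 x = 0.
  by move=> x0; rewrite /G0 set_itv_ge ?Rintegral_set0 // bnd_simp -ltNge.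
have G00 : G0 0 = 0 by rewrite /G0 set_itv1 Rintegral_set1.
have G0L x y : 0 <= x -> x <= y -> y <= t1 -> `|G0 y - G0 x| <= M * (y - x).
  move=> x0 xy yt.
  apply: le_trans (Rintegral_diff_le (T := t1) _ x0 xy yt) _; first exact: intf.
  have muxy : fine (mu `]x, y[) = y - x.
    rewrite lebesgue_measure_itv /= lte_fin; case: ltgtP xy => // [-> _]; by rewrite subrr.
  have iM : mu.-integrable `]x, y[ (EFin \o cst M).
    apply: integrableS (@continuous_integrable_itv (cst M) x y _) => //.
      exact: subset_itv_oo_cc.
    exact: cst_continuous.
  have ifn : mu.-integrable `]x, y[ (EFin \o (fun s => `|f s|)).
    apply: integrable_norm => //.
    by apply: integrableS (intf x y) => //; exact: subset_itv_oo_cc.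
  rewrite -muxy -Rintegral_cst //; apply: le_Rintegral => //.
  move=> s; rewrite /= in_itv /= => /andP[xs sy]; apply: fM.
  by rewrite (le_trans x0 (ltW xs)) (lt_le_trans sy yt).
have GL x y : x <= y -> `|G y - G x| <= M * (y - x).
  move=> xy; rewrite /G.
  set x' := Num.min x t1; set y' := Num.min y t1.
  have xy' : x' <= y' by rewrite le_min !ge_min xy lexx orbT.
  have yt' : y' <= t1 by rewrite ge_min lexx orbT.
  have dxy : y' - x' <= y - x.
    by rewrite /y' /x'; case: (leP x t1); case: (leP y t1); lra.
  apply: le_trans (_ : M * (y' - x') <= _); last by rewrite ler_wpM2l.
  have [x0|x0] := ltP x' 0; last exact: G0L.
  rewrite (G0N x') // subr0; have [y0|y0] := ltP y' 0.
    by rewrite (G0N y') // normr0 mulr_ge0 // subr_ge0.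
  have := G0L 0 y' (lexx 0) y0 yt'; rewrite G00 !subr0 => /le_trans; apply.
  by rewrite ler_wpM2l // lerDl oppr_ge0 ltW.
have cG : continuous G by exact: lipschitz_continuous_real GL.
have mG : measurable_fun setT G by exact: continuous_measurable_fun.
have GE x : x <= t1 -> G x = G0 x by move=> xt; rewrite /G min_l.
have Gz x : x <= t0 -> G x = 0.
  move=> xt; rewrite GE; last by apply: le_trans xt _; apply: le_trans t0t (ltW tt1).
  have [x0|x0] := ltP x 0; first exact: G0N.
  rewrite /G0 -Rintegral_itv_bndo_bndc; last first.
    by apply: integrableS (intf 0 x) => //; exact: subset_itv_co_cc.
  transitivity (\int[mu]_(s in `[0, x[) (0 : R)); last by rewrite Rintegral_cst ?mul0r.
  apply: eq_Rintegral => s.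
  by rewrite inE /= in_itv /= => /andP[s0 sx]; rewrite fz // s0 (lt_le_trans sx xt).
pose S := t1 - t0; have S0 : 0 <= S by rewrite subr_ge0; apply: le_trans t0t (ltW tt1).
pose K x := \int[mu]_(s in `[0, S]) (s `^ (alpha - 1) * G (x - s)).
have RLK x : t0 <= x <= t1 -> RL_conv alpha G x = K x.
  move=> /andP[t0x xt1]; rewrite /RL_conv /K.
  rewrite (Rintegral_reflect x); last first.
    apply: measurable_funM => //; apply: measurable_powR_comp.
    exact: measurable_funB.
  transitivity (\int[mu]_(s in `[0, x]) (s `^ (alpha - 1) * G (x - s))).
    by apply: eq_Rintegral => s _; rewrite subKr.
  (* Outside of the intersection of the two ranges G (x - s) is zero. *)
  apply: eq_Rintegral_support => s /=; rewrite !in_itv /= => /andP[s0 sx] /negP.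
    by rewrite s0 /= -ltNge /S => sS; rewrite Gz ?mulr0 //; lra.
  by rewrite s0 /= -ltNge => xs; rewrite Gz ?mulr0 //; lra.
have Gb x : `|G x| <= M * t1.
  have [x0|x0] := ltP x 0; first by rewrite Gz ?normr0 ?mulr_ge0 ?(ltW t10) //; lra.
  have m0 : 0 <= Num.min x t1 by rewrite le_min x0 ltW.
  have mt : Num.min x t1 <= t1 by rewrite ge_min lexx orbT.
  have := G0L 0 _ (lexx 0) m0 mt; rewrite G00 !subr0 => /le_trans; apply.
  by rewrite ler_wpM2l.
have iw := integrable_powR al0 S0.
have mGx x : measurable_fun setT (fun s : R => G (x - s)).
  by apply: measurableT_comp mG _; exact: measurable_funB.
have iK x : mu.-integrable `[0, S] (EFin \o (fun s => s `^ (alpha - 1) * G (x - s))).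
  apply: (integrable_weight _ iw (M := M * t1)) => //.
  exact: measurable_funTS (mGx x).
have KL x d : 0 < d -> `|K (x + d) - K x| <= M * d * (S `^ alpha / alpha).
  move=> d0; rewrite /K -RintegralB //.
  have -> : (S `^ alpha / alpha) = \int[mu]_(s in `[0, S]) s `^ (alpha - 1).
    by rewrite /Rintegral integral_powR.
  have -> : \int[mu]_(s in `[0, S])
      (s `^ (alpha - 1) * G (x + d - s) - s `^ (alpha - 1) * G (x - s)) =
      \int[mu]_(s in `[0, S]) (s `^ (alpha - 1) * (G (x + d - s) - G (x - s))).
    by apply: eq_Rintegral => s _; rewrite mulrBr.
  apply: (weighted_Rintegral_le _ iw (f := fun s => G (x + d - s) - G (x - s))) => //.
  - by apply: measurable_funB; apply: measurable_funTS; exact: mGx.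
  - by move=> s _; exact: powR_ge0.
  - move=> s _; have := @GL (x - s) (x + d - s).
    have -> : x + d - s - (x - s) = d by ring.
    by apply; lra.
have mh : measurable_fun setT h by exact: continuous_measurable_fun.
have Hint x : t0 <= x <= t1 ->
    \int[mu]_(s in `[0, x]) h s = k / Beta alpha (1 - alpha) * K x.
  move=> /andP[t0x xt1]; have x0 : 0 <= x := le_trans t00 t0x.
  have [Mh hM] := continuous_bounded_itv ch x0.
  have B0 := Beta_gt0 al0 oma0.
  have := RL_conv_comp al0 oma0 x0 mh hM.
  have -> : RL_conv alpha (RL_conv (1 - alpha) h) x = k * K x.
    rewrite -RLK ?t0x // /RL_conv -RintegralZl //.
      apply: eq_Rintegral => s; rewrite inE /= in_itv /= => /andP[s0 sx].
      rewrite -/(RL_conv (1 - alpha) h s) hJ; last first.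
        by rewrite s0 (le_trans sx (le_trans xt1 t1T)).
      by rewrite GE ?(le_trans sx) // mulrCA.
    apply: (integrable_RL_conv (M := M * t1)) => //.
  have -> : RL_conv (alpha + (1 - alpha)) h x = \int[mu]_(s in `[0, x]) h s.
    rewrite /RL_conv; apply: eq_Rintegral => s _.
    have -> : alpha + (1 - alpha) - 1 = 0 by ring.
    by rewrite powRr0 mul1r.
  move=> E; apply: (mulfI (lt0r_neq0 B0)); rewrite -E; field.
  by rewrite gt_eqF.
apply: (norm_le_of_average (t1 := t1)) => // d d0 dt.
have td : t <= t + d by rewrite lerDl ltW.
rewrite -(@Rintegral_itvB _ h (BLeft 0) (BRight (t + d)) t) ?bnd_simp ?(le_trans t00) //;
  last exact: continuous_integrable_itv.
rewrite !Hint ?t0t ?(ltW tt1) ?dt ?andbT ?(le_trans t0t) //.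
have B0 := Beta_gt0 al0 oma0.
have kB0 : 0 <= k / Beta alpha (1 - alpha) by rewrite divr_ge0 ?(ltW k0) ?(ltW B0).
rewrite -mulrBr normrM (ger0_norm kB0) -[leRHS]mulrA ler_wpM2l //.
by apply: le_trans (KL t d d0) _; rewrite mulrAC.
Qed.

End AbelLocalBound.

(** * Uniqueness *)

Section Uniqueness.
Variable R : realType.
Notation mu := (@lebesgue_measure R).

Lemma continuous_extension (f : R -> Cplx R) :
  {within `[0, +oo[, continuous f} -> continuous (fun t : R => f (Num.max 0 t)).
Proof.
move=> /subspace_continuousP cf t P nP.
have A0 s : `[0, +oo[%classic (Num.max 0 s : R) by rewrite /= in_itv /= andbT le_max lexx.
have H := cf _ (A0 t) P nP.
have cm : {for t, continuous (fun s : R => Num.max 0 s)}.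
  by apply: continuous_max; [exact: cst_continuous|exact: cvg_id].
change (\forall s \near t, P (f (Num.max 0 s))).
have H2 : \forall s \near t, `[0, +oo[%classic (Num.max 0 s : R) ->
    P (f (Num.max 0 s)) by exact: cm _ H.
by apply: filterS H2 => s /(_ (A0 s)).
Qed.

Lemma abs_continuous_uniform (a b : R) (f : R -> R[i]) : abs_continuous a b f ->
  forall e, 0 < e -> exists2 d, 0 < d &
    forall x y, a <= x -> x <= y -> y <= b -> y - x < d -> cmod (f y - f x) < e.
Proof.
move=> ac e e0; have [d d0 dP] := ac e e0; exists d => // x y ax xy yb xyd.
have := dP 1%N (fun _ => x) (fun _ => y); rewrite !big_ord1; apply => //.
by move=> i j _ _ _; rewrite (ord1 i) (ord1 j).
Qed.

(** The derivative is only known on the open half line, so the uniform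
    continuity assumption provides the right limit at 0. *)
Lemma indefinite_of_derivative (D f : R -> R) (T x : R) : continuous f -> D 0 = 0 ->
  (forall e, 0 < e -> exists2 d, 0 < d &
     forall x y, 0 <= x -> x <= y -> y <= T -> y - x < d -> `|D y - D x| < e) ->
  (forall t, 0 < t -> derivable D t 1 /\ derive1 D t = f t) ->
  0 <= x <= T -> D x = \int[mu]_(s in `[0, x]) f s.
Proof.
move=> cf D0 uc dD /andP[]; rewrite le_eqVlt => /predU1P[<- _|x0 xT].
  by rewrite set_itv1 Rintegral_set1.
rewrite /Rintegral (continuous_FTC2 (F := D) x0) ?D0 /= ?subr0 //.
- exact: continuous_subspaceT.
- have cD t : 0 < t -> {for t, continuous D}.
    move=> t0; apply: differentiable_continuous; apply/derivable1_diffP.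
    by case: (dD t t0).
  split.
  + by move=> t; rewrite in_itv /= => /andP[t0 _]; case: (dD t t0).
  + apply/cvgrPdist_lt => e e0; have [d d0 dP] := uc e e0.
    near=> t; rewrite distrC; apply: dP => //.
    * near: t; apply: nbhs_right_le; exact: lt_le_trans xT.
    * by rewrite subr0; near: t; exact: nbhs_right_lt.
  + by apply: cvg_at_left_filter; exact: cD.
- by move=> t; rewrite in_itv /= => /andP[t0 _]; case: (dD t t0).
Unshelve. all: by end_near. Qed.

Variable alpha : R.
Hypotheses (alpha_gt0 : 0 < alpha) (alpha_lt1 : alpha < 1).
Local Notation k := (Gamma (1 - alpha)).
Let k_gt0 : 0 < k. Proof. exact: Gamma_oma_gt0. Qed.

(** The length tau is chosen so that [Abel_local_bound], applied to both the
    real and the imaginary part, halves any bound of |Re h| + |Im h| on an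
    interval of length tau following a zero interval. *)
Lemma Volterra_zero (h a : R -> Cplx R) :
  continuous h -> continuous a ->
  (forall x, 0 <= x -> RL_conv (1 - alpha) (fun s => complex.Re (h s)) x =
     k * \int[mu]_(s in `[0, x]) complex.Re (a s * h s)) ->
  (forall x, 0 <= x -> RL_conv (1 - alpha) (fun s => complex.Im (h s)) x =
     k * \int[mu]_(s in `[0, x]) complex.Im (a s * h s)) ->
  forall t, 0 <= t -> h t = 0.
Proof.
move=> ch ca hRe hIm t t_ge0.
have cRe (f : R -> Cplx R) : continuous f -> continuous (fun x => complex.Re (f x)).
  by move=> cf x; apply: (continuous_comp (cf x)); exact: continuous_Re.
have cIm (f : R -> Cplx R) : continuous f -> continuous (fun x => complex.Im (f x)).
  by move=> cf x; apply: (continuous_comp (cf x)); exact: continuous_Im.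
have cF : continuous (fun s : R => a s * h s : Cplx R).
  by move=> x; apply: (@continuousM (Cplx R) R a h); [exact: ca|exact: ch].
pose T := t + 1; have T0 : 0 <= T by rewrite addr_ge0.
have [P1 P1P] := continuous_bounded_itv (cRe _ ca) T0.
have [P2 P2P] := continuous_bounded_itv (cIm _ ca) T0.
have [M1 M1P] := continuous_bounded_itv (cRe _ ch) T0.
have [M2 M2P] := continuous_bounded_itv (cIm _ ch) T0.
pose P := P1 + P2; pose M0 := M1 + M2.
pose N s := `|complex.Re (h s)| + `|complex.Im (h s)|.
have N0 s : 0 <= N s by rewrite addr_ge0.
have aP s : 0 <= s <= T -> cmod (a s) <= P.
  by move=> sT; apply: le_trans (cmod_le_ReIm _) _; rewrite lerD ?P1P ?P2P.
have P0 : 0 <= P by apply: le_trans (aP 0 _); rewrite ?cmod_ge0 ?lexx.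
have FN s : 0 <= s <= T -> cmod (a s * h s) <= P * N s.
  move=> sT; rewrite cmodM ler_pM ?cmod_ge0 ?aP //; exact: cmod_le_ReIm.
have B0 : 0 < Beta alpha (1 - alpha) by rewrite Beta_gt0 // subr_gt0.
have [C C0 CE] : exists2 C : R, 0 <= C & k / Beta alpha (1 - alpha) = C.
  by exists (k / Beta alpha (1 - alpha)) => //; rewrite divr_ge0 // ltW.
(* tau^alpha = 1/q makes 2 C P tau^alpha / alpha at most 1/2. *)
pose q := 4 * C * P / alpha + 1.
have q0 : 0 < q.
  by rewrite ltr_wpDl // divr_ge0 ?(ltW alpha_gt0) // !mulr_ge0.
pose tau := q^-1 `^ (alpha^-1).
have tau0 : 0 < tau by rewrite powR_gt0 // invr_gt0.
have tauE : tau `^ alpha = q^-1.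
  by rewrite /tau -powRrM mulVf ?gt_eqF // powRr1 // invr_ge0 ltW.
have step t0 t1 : 0 <= t0 -> t0 <= t1 -> t1 <= T -> t1 - t0 <= tau ->
    (forall s, 0 <= s < t0 -> h s = 0) -> forall s, 0 <= s < t1 -> h s = 0.
  move=> t00 t01 t1T dt hz.
  have dta : (t1 - t0) `^ alpha <= q^-1.
    rewrite -tauE; apply: ge0_ler_powR; rewrite ?nnegrE ?subr_ge0 ?(ltW alpha_gt0) //.
    exact: ltW.
  have contraction n s : 0 <= s < t1 -> N s <= M0 / 2 ^+ n.
    elim: n s => [|n IH] s /andP[s0 s1].
      have sT : 0 <= s <= T by rewrite s0 (le_trans (ltW s1)).
      by rewrite expr0 divr1 /N /M0 lerD ?M1P ?M2P.
    have Mn0 : 0 <= M0 / 2 ^+ n.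
      by apply: le_trans (IH 0 _); rewrite ?N0 ?lexx // (le_lt_trans s0 s1).
    have [st0|t0s] := ltP s t0.
      rewrite /N hz ?s0 //= normr0 addr0 exprS invfM mulrCA.
      by rewrite mulr_ge0 ?invr_ge0.
    have fM s' : 0 <= s' < t1 -> cmod (a s' * h s') <= P * (M0 / 2 ^+ n).
      move=> s'1; have /andP[s'0 /ltW s't] := s'1.
      apply: le_trans (FN s' _) _; first by rewrite s'0 (le_trans s't).
      by rewrite ler_wpM2l ?IH.
    have st : t0 <= s < t1 by rewrite t0s.
    have fz s' : 0 <= s' < t0 -> a s' * h s' = 0 :> R[i] by move=> /hz ->; rewrite mulr0.
    have bRe := Abel_local_bound (T := T) (t0 := t0) (t1 := t1)
      (M := P * (M0 / 2 ^+ n)) (t := s) alpha_gt0 alpha_lt1 k_gt0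
      (cRe _ ch) (cRe _ cF) (fun x xT => hRe x (proj1 (andP xT))) t00 t1T
      (fun s' s't => congr1 (fun z : R[i] => complex.Re z) (fz s' s't))
      (fun s' s't => le_trans (normr_Re_le _) (fM s' s't)) st.
    have bIm := Abel_local_bound (T := T) (t0 := t0) (t1 := t1)
      (M := P * (M0 / 2 ^+ n)) (t := s) alpha_gt0 alpha_lt1 k_gt0
      (cIm _ ch) (cIm _ cF) (fun x xT => hIm x (proj1 (andP xT))) t00 t1T
      (fun s' s't => congr1 (fun z : R[i] => complex.Im z) (fz s' s't))
      (fun s' s't => le_trans (normr_Im_le _) (fM s' s't)) st.
    apply: le_trans (lerD bRe bIm) _; rewrite CE.
    have bd : C * (P * (M0 / 2 ^+ n) * ((t1 - t0) `^ alpha / alpha)) <=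
        C * (P * (M0 / 2 ^+ n) * (q^-1 / alpha)).
      apply: (ler_wpM2l C0); apply: (ler_wpM2l (mulr_ge0 P0 Mn0)).
      by apply: ler_wpM2r dta; rewrite invr_ge0 ltW.
    apply: le_trans (lerD bd bd) _.
    have -> : M0 / 2 ^+ n.+1 = M0 / 2 ^+ n * 2^-1 by rewrite exprS invfM mulrA mulrAC.
    have -> : C * (P * (M0 / 2 ^+ n) * (q^-1 / alpha)) +
       C * (P * (M0 / 2 ^+ n) * (q^-1 / alpha)) = M0 / 2 ^+ n * (2 * C * P / alpha / q).
      by field; rewrite ?gt_eqF ?exprn_gt0.
    rewrite ler_wpM2l // ler_pdivrMr // /q.
    have : 0 <= 2 * C * P / alpha by rewrite divr_ge0 ?(ltW alpha_gt0) // !mulr_ge0.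
    have -> : 2^-1 * (4 * C * P / alpha + 1) = 2 * C * P / alpha + 2^-1.
      by field; rewrite gt_eqF.
    by move=> _; rewrite lerDl.
  move=> s st; have Nle : N s <= 0.
    by apply: (@le_dyadic_tail _ _ _ M0) => n; rewrite add0r; exact: contraction.
  apply: cmod_eq0; apply/eqP; rewrite eq_le cmod_ge0 andbT.
  exact: le_trans (cmod_le_ReIm _) Nle.
have zero n s : 0 <= s < Num.min (n%:R * tau) T -> h s = 0.
  elim: n s => [|n IH] s.
    by rewrite mul0r min_l // => /andP[s0 s1]; have := le_lt_trans s0 s1; rewrite ltxx.
  apply: (step (Num.min (n%:R * tau) T)) => //.
  - by rewrite le_min mulr_ge0 // (ltW tau0).
  - by rewrite le_min !ge_min lexx orbT ler_wpM2r ?(ltW tau0) // ler_nat.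
  - by rewrite ge_min lexx orbT.
  - rewrite -natr1 mulrDl mul1r.
    by case: (leP (n%:R * tau + tau) T); case: (leP (n%:R * tau) T); lra.
apply: (zero (Num.truncn (T / tau)).+1); rewrite t_ge0 lt_min /=; apply/andP; split.
  rewrite -ltr_pdivrMr //; apply: le_lt_trans (truncnS_gt _).
  by rewrite ler_pM2r ?invr_gt0 // lerDl.
by rewrite ltrDl.
Qed.

End Uniqueness.

Section CauchyUniqueness.
Variable R : realType.
Notation mu := (@lebesgue_measure R).
Variable alpha : R.
Hypotheses (alpha_gt0 : 0 < alpha) (alpha_lt1 : alpha < 1).
Local Notation k := (Gamma (1 - alpha)).
Let k_gt0 : 0 < k. Proof. exact: Gamma_oma_gt0. Qed.

Lemma RL_convB (b x : R) (f g : R -> R) : 0 < b -> 0 <= x ->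
  continuous f -> continuous g ->
  RL_conv b (fun s => f s - g s) x = RL_conv b f x - RL_conv b g x.
Proof.
move=> b0 x0 cf cg.
have [Mf fM] := continuous_bounded_itv cf x0.
have [Mg gM] := continuous_bounded_itv cg x0.
rewrite /RL_conv -RintegralB //.
- by apply: eq_Rintegral => s _; rewrite mulrBr.
- by apply: (integrable_RL_conv (M := Mf)) => //; exact: continuous_measurable_fun.
- by apply: (integrable_RL_conv (M := Mg)) => //; exact: continuous_measurable_fun.
Qed.

Section Projection.
Variables (p : R[i] -> R) (w1 w2 : R -> R[i]) (F : R -> R[i]).
Hypothesis pB : forall x y, p (x - y) = p x - p y.
Hypothesis p_cmod : forall z, `|p z| <= cmod z.
Hypothesis p_cont : continuous (p : Cplx R -> R).
Let W w (t : R) : R[i] := w (Num.max 0 t).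
Hypothesis p_RLint : forall w x,
  p (RLint alpha w x) = k^-1 * RL_conv (1 - alpha) (fun s => p (W w s)) x.
Hypotheses (c1 : {within `[0, +oo[, continuous (w1 : R -> Cplx R)})
  (c2 : {within `[0, +oo[, continuous (w2 : R -> Cplx R)})
  (cF : continuous (F : R -> Cplx R)).
Hypotheses (ac1 : has_RLderive alpha w1) (ac2 : has_RLderive alpha w2).
Hypothesis dp : forall t, 0 < t ->
  [/\ derivable (fun x => p (RLint alpha w1 x)) t 1,
      derivable (fun x => p (RLint alpha w2 x)) t 1
    & derive1 (fun x => p (RLint alpha w1 x)) t -
      derive1 (fun x => p (RLint alpha w2 x)) t = p (F t)].

(** Stated for a real-linear contraction p, to be used with both the real and
    the imaginary part.  The Caputo corrections of the two solutions cancel, so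
    the difference of their Riemann-Liouville integrals is a true indefinite
    integral. *)
Lemma RL_conv_difference x : 0 <= x ->
  RL_conv (1 - alpha) (fun s => p (W w1 s - W w2 s)) x =
  k * \int[mu]_(s in `[0, x]) p (F s).
Proof.
move=> x0; pose D t := p (RLint alpha w1 t) - p (RLint alpha w2 t).
have oma0 : 0 < 1 - alpha by rewrite subr_gt0.
have cW w : {within `[0, +oo[, continuous (w : R -> Cplx R)} ->
    continuous (fun s => p (W w s)).
  move=> cw s; apply: (@continuous_comp R (Cplx R) R (fun s => W w s) p s).
    exact: (continuous_extension cw).
  exact: p_cont.
have DE : RL_conv (1 - alpha) (fun s => p (W w1 s - W w2 s)) x = k * D x.
  have -> : (fun s => p (W w1 s - W w2 s)) = (fun s => p (W w1 s) - p (W w2 s)).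
    by apply/funext => s; rewrite pB.
  rewrite (RL_convB oma0 x0 (cW _ c1) (cW _ c2)) /D !p_RLint.
  by field; rewrite gt_eqF.
rewrite DE; congr (_ * _).
apply: (@indefinite_of_derivative _ D (fun s => p (F s)) (x + 1)).
- by move=> s; apply: (@continuous_comp R (Cplx R) R F p s); [exact: cF|exact: p_cont].
- by rewrite /D !p_RLint /RL_conv set_itv1 !Rintegral_set1 subrr.
- have subACA (a b c d : R) : a - b - (c - d) = a - c - (b - d) by ring.
  move=> e e0; have e2 : 0 < e / 2 by rewrite divr_gt0.
  have x1 : 0 < x + 1 by rewrite ltr_wpDl.
  have [d1 d10 d1P] := abs_continuous_uniform (ac1 x1) e2.
  have [d2 d20 d2P] := abs_continuous_uniform (ac2 x1) e2.
  exists (Num.min d1 d2); first by rewrite lt_min d10.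
  move=> y z y0 yz zx; rewrite lt_min => /andP[yz1 yz2].
  have -> : D z - D y = p (RLint alpha w1 z - RLint alpha w1 y) -
      p (RLint alpha w2 z - RLint alpha w2 y) 
    by rewrite /D !pB; exact: subACA.
  apply: le_lt_trans (ler_normB _ _) _; rewrite [e]splitr; apply: ltrD.
    exact: le_lt_trans (p_cmod _) (d1P y z y0 yz zx yz1).
  exact: le_lt_trans (p_cmod _) (d2P y z y0 yz zx yz2).
- move=> t t0; have [h1 h2 h3] := dp t0; split.
    exact: derivableB h1 h2.
  rewrite -h3 !derive1E; exact: deriveB h1 h2.
- by rewrite x0 lerDl ler01.
Qed.

End Projection.

Lemma Cauchy_solution_unique (A : {poly R[i]}) (u0 : R[i]) (w1 w2 : R -> R[i]) :
  Cauchy_solution alpha A u0 w1 -> Cauchy_solution alpha A u0 w2 ->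
  forall t, 0 <= t -> w1 t = w2 t.
Proof.
move=> [c1 ac1 e1 i1] [c2 ac2 e2 i2] t t0.
pose h (s : R) : Cplx R := w1 (Num.max 0 s) - w2 (Num.max 0 s).
pose a (s : R) : Cplx R := A.[((Num.max 0 s) `^ alpha)%:C].
have ch : continuous h.
  move=> s; apply: (@continuousB (Cplx R) (Cplx R) R (fun s => w1 (Num.max 0 s))
    (fun s => w2 (Num.max 0 s))); exact: continuous_extension.
have ca : continuous a.
  apply: (@continuous_extension _ (fun s => A.[(s `^ alpha)%:C])).
  apply: (@within_continuous_comp _ _ _ _ (fun s : R => s `^ alpha)
    (fun x : R => A.[x%:C] : Cplx R)); last exact: within_continuous_powR.
  move=> x _; apply: (continuous_comp (@continuous_real_complex R x)).
  exact: continuous_horner_complex.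
have cF : continuous (fun s : R => a s * h s : Cplx R).
  by move=> x; apply: (@continuousM (Cplx R) R a h); [exact: ca|exact: ch].
have dE s : 0 < s -> RLderive alpha w1 s - RLderive alpha w2 s = a s * h s.
  move=> s0; have [[_ E1] [_ E2]] := (e1 s s0, e2 s s0).
  rewrite /a /h max_r ?(ltW s0) // mulrBr -E1 -E2 /Caputo i1 i2.
  by rewrite opprB addrA subrK.
have expE : 1 - alpha - 1 = - alpha by ring.
have pRe w x : complex.Re (RLint alpha w x) =
    k^-1 * RL_conv (1 - alpha) (fun s => complex.Re (w (Num.max 0 s))) x.
  rewrite /RLint ReZ /RL_conv expE; congr (_ * _); apply: eq_Rintegral => s.
  by rewrite inE /= in_itv /= => /andP[s0 _]; rewrite ReZ max_r.
have pIm w x : complex.Im (RLint alpha w x) =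
    k^-1 * RL_conv (1 - alpha) (fun s => complex.Im (w (Num.max 0 s))) x.
  rewrite /RLint ImZ /RL_conv expE; congr (_ * _); apply: eq_Rintegral => s.
  by rewrite inE /= in_itv /= => /andP[s0 _]; rewrite ImZ max_r.
have h0 : h t = 0.
  apply: (Volterra_zero alpha_gt0 alpha_lt1 ch ca) t0 => x x0.
  - apply: (@RL_conv_difference (fun z => complex.Re z) w1 w2 (fun s => a s * h s)
      (@ReB R) (@normr_Re_le R) (@continuous_Re R) pRe c1 c2 cF ac1 ac2 _ x x0).
    move=> s s0; have [[[d1 _] _] [[d2 _] _]] := (e1 s s0, e2 s s0).
    by split => //; rewrite -dE // ReB.
  - apply: (@RL_conv_difference (fun z => complex.Im z) w1 w2 (fun s => a s * h s)
      (@ImB R) (@normr_Im_le R) (@continuous_Im R) pIm c1 c2 cF ac1 ac2 _ x x0).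
    move=> s s0; have [[[_ d1] _] [[_ d2] _]] := (e1 s s0, e2 s s0).
    by split => //; rewrite -dE // ImB.
move: h0; rewrite /h max_r // => /eqP; rewrite subr_eq0 => /eqP; exact.
Qed.

End CauchyUniqueness.

(** * Solution of the Cauchy problem *)

Theorem theorem1 (R : realType) (alpha : R) (m : nat) (A : {poly R[i]})
    (u0 : R[i]) (alpha_gt0 : 0 < alpha) (alpha_lt1 : alpha < 1)
    (degA : size A = m.+1) :
  exists u : R -> R[i],
    [/\ Cauchy_solution alpha A u0 u,
        (forall w : R -> R[i], Cauchy_solution alpha A u0 w ->
           forall t : R, 0 <= t -> w t = u t)
      & exists v : R[i] -> R[i],
          [/\ entire v,
              (entire_order v <= ((1 + m%:R) / alpha)%:E)%E
            & forall t : R, 0 <= t -> u t = v (t `^ alpha)%:C]].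
Proof.
have [kappa kappa0 kappaP] := RL_symbol_ge alpha_gt0 alpha_lt1.
have [n f g fg|c [c0 cS]] := @exists_recursive_sequence R[i] u0 (fun n f =>
    ((RL_symbol alpha n.+1)^-1)%:C * \sum_(j < m.+1 | (j <= n)%N) A`_j * f (n - j)%N).
  by congr (_ * _); apply: eq_bigr => j _; rewrite fg // leq_subr.
have [L L0 cL] := coef_growth (a := fun j => A`_j) alpha_gt0 kappa0 kappaP cS.
pose sg : R := alpha / m.+1%:R.
have sg0 : 0 < sg by rewrite divr_gt0 // ltr0n.
pose E (x : R) := cmod u0 * expR (sg * (2 * (L * x)) `^ sg^-1).
have cE (x : R) n : 0 <= x -> cmod (c n) * x ^+ n <= E x / 2 ^+ n.
  move=> x0; apply: le_trans (ler_wpM2r (exprn_ge0 n x0) (cL n)) _.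
  have Lx0 : 0 <= L * x by rewrite mulr_ge0 // ltW.
  have -> : cmod (c 0%N) * L ^+ n / n`!%:R `^ (alpha / m.+1%:R) * x ^+ n =
      cmod u0 * ((L * x) ^+ n / n`!%:R `^ sg).
    by rewrite c0 exprMn /sg; ring.
  by rewrite /E -mulrA ler_wpM2l ?cmod_ge0 // exprn_div_fact_powR_le.
have E_homo x y : 0 <= x -> x <= y -> E x <= E y.
  move=> x0 xy; rewrite /E ler_wpM2l ?cmod_ge0 // ler_expR ler_wpM2l ?(ltW sg0) //.
  have y0 := le_trans x0 xy.
  apply: ge0_ler_powR; rewrite ?nnegrE ?invr_ge0 ?(ltW sg0) ?mulr_ge0 ?(ltW L0) //.
  by rewrite !ler_wpM2l // ltW.
have [v vP] := exists_series_sum cE.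
have sol := series_solution alpha_gt0 alpha_lt1 degA cS cE E_homo vP.
rewrite c0 in sol.
exists (fun t => v (t `^ alpha)%:C); split.
- exact: sol.
- by move=> w hw t t0; exact: (Cauchy_solution_unique alpha_gt0 alpha_lt1 hw sol).
- exists v; split => //; first exact: (series_sum_entire cE vP).
  have -> : (1 + m%:R) / alpha = sg^-1 by rewrite /sg invf_div nat1r.
  apply: (@entire_order_le _ v (4 * cmod u0) (sg * (2 * L) `^ sg^-1)).
  + by rewrite mulr_ge0 ?cmod_ge0.
  + by rewrite mulr_gt0 // powR_gt0 // mulr_gt0.
  + by rewrite invr_gt0.
  + move=> z; apply: le_trans (series_sum_le z vP) _.
    have L20 : 0 <= 2 * L by rewrite mulr_ge0 // ltW.
    by rewrite /E mulrA [2 * (L * _)]mulrA powRM ?cmod_ge0 // mulrA.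
Qed.
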